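(* Let $(F_n)_{n\in\mathbb{N}}$ be a sequence of quasi-infinitely divisible distribution functions with spectral pairs $(\gamma_n,G_n)$, $\gamma_n\in\mathbb{R}$, $G_n\in\boldsymbol{V}$, $n\in\mathbb{N}$. Suppose that for some decompositions $$G_n(x)=G_n^+(x)-G_n^-(x),\quad x\in\mathbb{R},\ n\in\mathbb{N},$$ with non-decreasing functions $G_n^+,G_n^-\in\boldsymbol{V}$, one has $\varlimsup_{n\to\infty}G_n^-(+\infty)<\infty$. Let $F$ be a quasi-infinitely divisible distribution function with spectral pair $(\gamma,G)$, where $\gamma\in\mathbb{R}$ and $G\in\boldsymbol{V}$. The sequence $(F_n)_{n\in\mathbb{N}}$ weakly converges to $F$ if and only if $(F_n)_{n\in\mathbb{N}}$ is relatively compact and $\gamma_n\to\gamma$, $G_n\Rightarrow G$ (basic convergence), and $G_n(+\infty)\to G(+\infty)$, $n\to\infty$.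
   Context: $\boldsymbol{V}$ denotes the class of all functions $G:\mathbb{R}\to\mathbb{R}$ of bounded variation on $\mathbb{R}$ that are right-continuous at every point and satisfy $G(-\infty)=0$, where $G(\pm\infty)$ denote the limits at $\pm\infty$. Integrals $\int_{\mathbb{R}} h\,dG$ are with respect to the finite signed Lebesgue--Stieltjes measure $\mu_G$ with $\mu_G((a,b])=G(b)-G(a)$. A number $\tau>0$ is fixed throughout. A (probability) distribution function $F$ on $\mathbb{R}$ is quasi-infinitely divisible if its characteristic function $f(t)=\int_{\mathbb{R}}e^{itx}\,dF(x)$ has the form $$f(t)=\exp\Bigl\{it\gamma+\int_{\mathbb{R}}\Bigl(e^{itx}-1-\tfrac{it}{\tau}\sin(\tau x)\Bigr)\tfrac{1+x^2}{x^2}\,dG(x)\Bigr\},\quad t\in\mathbb{R},$$ with some $\gamma\in\mathbb{R}$ and $G\in\boldsymbol{V}$ (the integrand at $x=0$ is defined by continuity, i.e. equals $-t^2/2$). The pair $(\gamma,G)$ is uniquely determined by $F$ and is called its spectral pair. (The property does not depend on $\tau$; $\gamma$ depends on $\tau$ but $G$ does not. All spectral pairs are taken with the same fixed $\tau$.) Basic convergence: for $G_n,G\in\boldsymbol{V}$, $(G_n)_{n\in\mathbb{N}}$ converges basically to $G$, written $G_n\Rightarrow G$, $n\to\infty$, if every subsequence of $(G_n)_{n\in\mathbb{N}}$ contains a further subsequence $(G_{n_k})_{k\in\mathbb{N}}$ for which there is an at most countable set $D\subset\mathbb{R}$ (depending in general on the choice of the subsequences) such that $G_{n_k}(x_2)-G_{n_k}(x_1)\to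 G(x_2)-G(x_1)$, $k\to\infty$, for all $x_1,x_2\in\mathbb{R}\setminus D$. Weak convergence of $(F_n)$ to $F$ means $\int_{\mathbb{R}}h\,dF_n\to\int_{\mathbb{R}}h\,dF$ for every bounded continuous $h:\mathbb{R}\to\mathbb{R}$. A sequence $(F_n)_{n\in\mathbb{N}}$ of distribution functions is relatively compact if every subsequence contains a further subsequence that weakly converges to a distribution function. *)

(* Defs.v *)
From HB Require Import structures.
From mathcomp Require Import all_boot all_order all_algebra.
From mathcomp Require Import complex.
From mathcomp Require Import all_classical all_reals all_analysis.
Set Implicit Arguments.
Unset Strict Implicit.
Unset Printing Implicit Defensive.
Import Order.TTheory GRing.Theory Num.Theory.
Import numFieldNormedType.Exports.
Local Open Scope classical_set_scope.
Local Open Scope ring_scope.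
Local Open Scope complex_scope.

(* Probability distribution functions on the line, represented as functions:
   non-decreasing, right-continuous, with limits 0 at -oo and 1 at +oo. *)
Notation dfun R := (cumulativeBounded (0 : R) (1 : R)).

Section defs.
Context {R : realType}.

Definition cexp (z : R[i]) : R[i] :=
  (expR (complex.Re z) * cos (complex.Im z)) +i*
  (expR (complex.Re z) * sin (complex.Im z)).

Definition char_fun (F : dfun R) (t : R) : R[i] :=
  let mu := lebesgue_stieltjes_measure F in
  (\int[mu]_x complex.Re (cexp (0 +i* (t * x)))) +i*
  (\int[mu]_x complex.Im (cexp (0 +i* (t * x)))).

(* Unlike the library's [bounded_variation a b], this is bounded variation on
   the whole line: the variations over compact intervals are bounded uniformly
   in the interval. *)
Definition bounded_variationT (G : R -> R) : Prop :=
  exists M : R, forall a b : R, a <= b -> (total_variation a b G <= M%:E)%E.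

(* The class V. *)
Definition classV (G : R -> R) : Prop :=
  [/\ bounded_variationT G, right_continuous G & G x @[x --> -oo] --> 0].

(* G(+oo); the limit exists as soon as G has bounded variation on the line. *)
Definition at_pinfty (G : R -> R) : R := lim (G x @[x --> +oo]).

(* Charges are finite, so [nu] is the finite signed measure mu_G; for G in V it
   exists, and it is determined by its values on the intervals ]a, b]. *)
Definition is_stieltjes_charge (G : R -> R)
    (nu : {charge set (measurableTypeR R) -> \bar R}) : Prop :=
  forall a b : R, a <= b -> nu `]a, b]%classic = (G b - G a)%:E.

(* Integral against a signed measure: the difference of the integrals against
   the two measures of its Jordan decomposition (which does not depend on the
   Hahn decomposition selected by [cid]). *)
Definition charge_integral (nu : {charge set (measurableTypeR R) -> \bar R})
    (h : R -> R) : R :=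
  let PN := svalP (cid (svalP (cid (Hahn_decomposition nu)))) in
  \int[jordan_pos PN]_x h x - \int[jordan_neg PN]_x h x.

Definition charge_cintegral (nu : {charge set (measurableTypeR R) -> \bar R})
    (h : R -> R[i]) : R[i] :=
  charge_integral nu (fun x => complex.Re (h x)) +i*
  charge_integral nu (fun x => complex.Im (h x)).

(* The value at x = 0 is the limit of the other branch as x tends to 0. *)
Definition levy_kernel (tau t x : R) : R[i] :=
  if x == 0 then (- (t ^+ 2 / 2))%:C
  else (cexp (0 +i* (t * x)) - 1 - (0 +i* (t / tau * sin (tau * x))))
       * ((1 + x ^+ 2) / x ^+ 2)%:C.

(* F is quasi-infinitely divisible with spectral pair (gamma, G). *)
Definition spectral_pair (tau : R) (F : dfun R) (gamma : R) (G : R -> R)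
    : Prop :=
  classV G /\
  exists nu : {charge set (measurableTypeR R) -> \bar R},
    is_stieltjes_charge G nu /\
    forall t : R, char_fun F t =
      cexp ((0 +i* (t * gamma)) + charge_cintegral nu (levy_kernel tau t)).

Definition subseq_index (s : nat -> nat) : Prop :=
  {homo s : m n / (m < n)%N >-> (m < n)%N}.

Definition basic_cvg (G_ : nat -> R -> R) (G : R -> R) : Prop :=
  forall s : nat -> nat, subseq_index s ->
  exists r : nat -> nat, subseq_index r /\
  exists D : set R, countable D /\
  forall x1 x2 : R, ~ D x1 -> ~ D x2 ->
    G_ (s (r k)) x2 - G_ (s (r k)) x1 @[k --> \oo] --> G x2 - G x1.

Definition weak_cvg (F_ : nat -> dfun R) (F : dfun R) : Prop :=
  forall h : R -> R, continuous h -> (exists M : R, forall x, `|h x| <= M) ->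
    \int[lebesgue_stieltjes_measure (F_ n)]_x h x @[n --> \oo] -->
    \int[lebesgue_stieltjes_measure F]_x h x.

Definition relatively_compact (F_ : nat -> dfun R) : Prop :=
  forall s : nat -> nat, subseq_index s ->
  exists r : nat -> nat, subseq_index r /\
  exists F : dfun R, weak_cvg (fun k => F_ (s (r k))) F.

End defs.

(* Main.v *)
Require Import Defs.
From HB Require Import structures.
From mathcomp Require Import all_boot all_order all_algebra.
From mathcomp Require Import complex.
From mathcomp Require Import all_classical all_reals all_analysis.
From mathcomp Require Import measurable_realfun.
From mathcomp Require Import ring lra.
Set Implicit Arguments.
Unset Strict Implicit.
Unset Printing Implicit Defensive.
Import Order.TTheory GRing.Theory Num.Theory.
Import numFieldNormedType.Exports.
Local Open Scope classical_set_scope.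
Local Open Scope ring_scope.

(** Write f_n = exp psi_n for the characteristic function of F_n, and R_n for
    the signed measure of G_n - G.  The proof rests on three properties of the
    kernel in the exponent.

    - Its real part is the opposite of
      cosker u x = (1 - cos (u x)) (1 + x^2) / x^2,
      and the average of [cosker u x] over u against exp (- u) equals 1 for
      every x.  Since
      psi (t + u) + psi (t - u) - 2 psi t = - 2 int e^(i t x) cosker u x dG(x),
      averaging second differences of psi_n recovers the Fourier transform of
      G_n itself, without any weight.
    - Its imaginary part vanishes identically at u = tau, so that
      Im psi_n (tau) = tau gamma_n: the drift is a value of the exponent.
    - It differs from e^(i u x) - 1 - (i u / tau) sin (tau x) by a continuous
      function of x that vanishes at infinity.

    Necessity.  Weak convergence makes f_n converge to f locally uniformly; f has
    no zeros, so psi_n converges to psi locally uniformly ([exponents_cvg], by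
    continuity of the argument), and gamma_n converges.  Real parts being
    bounded on a compact interval, and the negative parts having bounded mass,
    averaging the real part against exp (- u) bounds the mass of the positive
    parts ([positive_part_bounded]); averaging second differences shows that the
    Fourier transform of R_n tends to 0 pointwise
    ([signed_difference_fourier_cvg0]).  At 0 this is convergence of the total
    masses.  Smoothing with Poisson kernels, whose primitives are arctangents
    approximating indicators of intervals, and choosing by Helly's theorem a
    subsequence along which the total variation does not concentrate near the
    endpoints, one gets R_n ]a, b] -> 0 off a countable set
    ([sint_itv_cvg0_subseq]), that is basic convergence.

    Sufficiency.  Convergence of the total masses bounds the positive parts, so
    |f_n| is bounded below on compact sets; relative compactness makes the f_n,
    hence the psi_n, equicontinuous along a subsequence.  Basic convergence
    only controls integrals of functions vanishing at infinity, and mass of R_n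
    may escape to infinity.  However the average of u |-> e^(i u x) over a short
    interval does vanish as x tends to infinity, so the averages of the Fourier
    transforms of R_n tend to 0, and equicontinuity removes the averaging
    ([sint_cvg0_of_equicontinuous]).  The bounded quantity int sin (tau x) dR_n
    tends to 0 by looking at the point tau, where the imaginary part of the
    kernel vanishes.  Hence f_n -> f along the subsequence, and Levy's continuity
    theorem ([levy_continuity]) concludes.

    Signed measures are handled as pairs of finite measures, [sint p m h] being
    the integral of h against p - m. *)

(** * Bounded measurable functions and finite measures *)

Section bounded_measurable.
Context d (X : measurableType d) (R : realType).
Implicit Types (h g : X -> R) (p : {finite_measure set X -> \bar R}).

Definition bmeas h := measurable_fun setT h /\ exists M, forall x, `|h x| <= M.

Definition mass p : R := fine (p setT).

Lemma mass_ge0 p : 0 <= mass p.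
Proof. exact: fine_ge0. Qed.

Lemma massE p : (mass p)%:E = p setT.
Proof. by rewrite /mass fineK// fin_num_measure. Qed.

Lemma bmeas_integrable p h : bmeas h -> p.-integrable setT (EFin \o h).
Proof.
move=> [mh [M hM]]; apply: measurable_bounded_integrable => //.
  by rewrite ltey_eq fin_num_measure.
by exists M; split; [exact: num_real|move=> x Mx y _; exact: (le_trans (hM y) (ltW Mx))].
Qed.

Lemma bmeas_cst (c : R) : bmeas (fun=> c).
Proof. by split; [exact: measurable_cst|exists `|c|]. Qed.

Lemma bmeasD h g : bmeas h -> bmeas g -> bmeas (fun x => h x + g x).
Proof.
move=> [mh [M hM]] [mg [N gN]]; split; first exact: measurable_funD.
by exists (M + N) => x; rewrite (le_trans (ler_normD _ _))// lerD.
Qed.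

Lemma bmeasM h g : bmeas h -> bmeas g -> bmeas (fun x => h x * g x).
Proof.
move=> [mh [M hM]] [mg [N gN]]; split; first exact: measurable_funM.
by exists (M * N) => x; rewrite normrM ler_pM.
Qed.

Lemma bmeasZ (c : R) h : bmeas h -> bmeas (fun x => c * h x).
Proof. exact/bmeasM/bmeas_cst. Qed.

Lemma bmeasN h : bmeas h -> bmeas (fun x => - h x).
Proof. by move=> bh; under eq_fun do rewrite -mulN1r; exact: bmeasZ. Qed.

Lemma bmeasB h g : bmeas h -> bmeas g -> bmeas (fun x => h x - g x).
Proof. by move=> bh bg; apply: bmeasD => //; exact: bmeasN. Qed.

Lemma bmeas_norm h : bmeas h -> bmeas (fun x => `|h x|).
Proof.
by move=> [mh [M hM]]; split; [exact: measurableT_comp|exists M => x; rewrite normr_id].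
Qed.

Lemma bmeas_indic (A : set X) : measurable A -> bmeas \1_A.
Proof.
move=> mA; split; first exact: measurable_indic.
by exists 1 => x; rewrite indicE; case: (x \in A); rewrite ?normr1 ?normr0.
Qed.

Lemma le_Rint p h g : bmeas h -> bmeas g -> (forall x, h x <= g x) ->
  \int[p]_x h x <= \int[p]_x g x.
Proof. by move=> bh bg hg; apply: le_Rintegral => //; exact: bmeas_integrable. Qed.

Lemma Rint_cst p (c : R) : \int[p]_x c = c * mass p.
Proof. by rewrite Rintegral_cst. Qed.

Lemma Rint_indic p (A : set X) : measurable A -> \int[p]_x \1_A x = fine (p A).
Proof. by move=> mA; rewrite /Rintegral integral_indic// setIT. Qed.

Lemma normr_Rint_le p h (c : R) : bmeas h -> (forall x, `|h x| <= c) ->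
  `|\int[p]_x h x| <= c * mass p.
Proof.
move=> bh hc; rewrite (le_trans (le_normr_Rintegral _ _))//.
  exact: bmeas_integrable.
by rewrite -Rint_cst le_Rint//; [exact: bmeas_norm|exact: bmeas_cst].
Qed.

Lemma Rint_bounded_cvg p (h_ : nat -> X -> R) h (C : R) :
  (forall n, measurable_fun setT (h_ n)) -> (forall n x, `|h_ n x| <= C) ->
  (forall x, h_ n x @[n --> \oo] --> h x) ->
  \int[p]_x h_ n x @[n --> \oo] --> \int[p]_x h x.
Proof.
move=> mh_ hC hh.
have mh : measurable_fun setT h.
  by apply: (measurable_fun_cvg mh_) => x _; exact: hh.
have [] := @dominated_convergence _ X R p setT measurableT
  (fun n => EFin \o h_ n) (EFin \o h) (cst C%:E).
- by move=> n; apply/measurable_EFinP; exact: mh_.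
- exact/measurable_EFinP.
- by apply: aeW => x _; apply: cvg_EFin; [exact: nearW|exact: hh].
- exact: (bmeas_integrable p (bmeas_cst C)).
- by apply: aeW => x n _; rewrite lee_fin hC.
move=> ih _ cv; apply: (fine_cvg (f := fun n => (\int[p]_x (h_ n x)%:E)%E)).
rewrite /Rintegral fineK//.
exact: integrable_fin_num.
Qed.

End bounded_measurable.
Arguments mass {d X R} p.

Section measurable_compositions.
Context d (X : measurableType d) (R : realType).
Implicit Types f g : X -> R.

Lemma measurable_cos_comp f : measurable_fun setT f ->
  measurable_fun setT (fun x => cos (f x)).
Proof.
move=> mf; apply: (measurableT_comp _ mf).
by apply: continuous_measurable_fun; exact: continuous_cos.
Qed.

Lemma measurable_sin_comp f : measurable_fun setT f ->
  measurable_fun setT (fun x => sin (f x)).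
Proof.
move=> mf; apply: (measurableT_comp _ mf).
by apply: continuous_measurable_fun; exact: continuous_sin.
Qed.

Lemma measurable_expR_comp f : measurable_fun setT f ->
  measurable_fun setT (fun x => expR (f x)).
Proof. by move=> mf; apply: (measurableT_comp _ mf); exact: measurable_expR. Qed.

Lemma measurable_inv_comp f : measurable_fun setT f ->
  measurable_fun setT (fun x => (f x)^-1).
Proof.
move=> mf; suff mi : measurable_fun setT (@GRing.inv R) by exact: measurableT_comp.
rewrite -(setvU [set 0 : R]); apply/measurable_funU => //; first exact: measurableC.
split; last exact: measurable_fun_set1.
apply: open_continuous_measurable_fun; first exact/closed_openC/accessible_closed_set1/hausdorff_accessible/Rhausdorff.
by move=> x; rewrite inE/= => /eqP x0; exact: inv_continuous.
Qed.

End measurable_compositions.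

Ltac meas := repeat first [ exact: measurable_fst | exact: measurable_snd |
  exact: measurable_id | exact: measurable_cst |
  apply: measurable_cos_comp | apply: measurable_sin_comp |
  apply: measurable_expR_comp | apply: measurable_inv_comp | apply: measurable_funM |
  apply: measurable_funD | apply: measurable_funB | apply: measurable_funN |
  apply: measurable_funX ].


(** * Exchanging a finite measure with an average over an interval *)

Section fubini.
Context d (X : measurableType d) (R : realType).
Implicit Types (p : {finite_measure set X -> \bar R}) (a b C : R).
Local Notation leb := (@lebesgue_measure R).

(** Joint measurability together with a bound on the strip of parameters that
    is integrated over: what Fubini's theorem needs for a finite measure. *)
Definition jbounded (K : R -> X -> R) a b C :=
  measurable_fun setT (fun z : R * X => K z.1 z.2) /\
  forall u x, u \in `[a, b] -> `|K u x| <= C.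

Lemma jbounded_bmeas K a b C : jbounded K a b C ->
  forall u, u \in `[a, b] -> bmeas (K u).
Proof.
move=> [mK KC] u uab; split; last by exists C => x; exact: KC.
exact: (measurableT_comp mK (measurable_pair1 u)).
Qed.

(* K restricted to the strip, so that Fubini's theorem applies to the full
   Lebesgue measure. *)
Let cut (K : R -> X -> R) a b (z : R * X) := \1_(`[a, b]%classic) z.1 * K z.1 z.2.

Let cutE K a b x :
  \int[leb]_u cut K a b (u, x) = \int[leb]_(u in `[a, b]) K u x.
Proof.
rewrite [RHS]Rintegral_mkcond; apply: eq_Rintegral => u _.
by rewrite /cut/= patchE indicE; case: ifP => _; rewrite ?mul1r ?mul0r.
Qed.

Let measurable_cut K a b C : jbounded K a b C -> measurable_fun setT (cut K a b).
Proof.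
move=> [mK _]; apply: measurable_funM => //.
by apply: measurableT_comp => //; exact: measurable_indic.
Qed.

Let cut_le K a b C : jbounded K a b C ->
  forall z, `|cut K a b z| <= `|C| * \1_(`[a, b]%classic) z.1.
Proof.
move=> [mK KC] [u x]; rewrite /cut/= indicE normrM.
case: (boolP (u \in `[a, b]%classic)) => [|_]; last by rewrite normr0 mul0r mulr0.
by rewrite inE/= => uab; rewrite normr1 mul1r mulr1 (le_trans (KC _ _ uab))// ler_norm.
Qed.

Let leb_itv_lty a b : (leb `[a, b]%classic < +oo)%E.
Proof. by rewrite /= lebesgue_measure_itv/=; case: ifP => _; rewrite ?ltry// -EFinB ltry. Qed.

Let cut_integrable K a b C p : jbounded K a b C ->
  (leb \x p)%E.-integrable setT (EFin \o cut K a b).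
Proof.
move=> bK; have mc := measurable_cut bK.
apply/integrable12ltyP; first exact/measurable_EFinP.
have mi : measurable_fun setT (\1_(`[a, b]%classic) : R -> R).
  exact: measurable_indic.
apply: (@le_lt_trans _ _ (\int[leb]_u (`|C| * mass p * \1_(`[a, b]%classic) u)%:E)%E).
  apply: ge0_le_integral => //.
  - by move=> u _; exact: integral_ge0.
  - apply: (@measurable_fun_fubini_tonelli_F _ _ R X R p
      (fun z => `|(EFin \o cut K a b) z|%E)) => //.
    by apply/measurableT_comp => //; exact/measurable_EFinP.
  - by apply/measurable_EFinP; exact: measurable_funM.
  move=> u _ /=.
  apply: (@le_trans _ _ (\int[p]_x (`|C| * \1_(`[a, b]%classic) u)%:E)%E).
    apply: ge0_le_integral => //.
    - apply/measurable_EFinP; apply: measurableT_comp => //.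
      exact: (measurableT_comp mc (measurable_pair1 u)).
    - by move=> x _; rewrite lee_fin (cut_le bK).
  rewrite integral_cst//= [X in (_ * X)%E](_ : _ = (mass p)%:E); last by rewrite massE.
  by rewrite -EFinM mulrAC.
under eq_integral do rewrite EFinM.
rewrite ge0_integralZl//; last 2 first.
- exact/measurable_EFinP.
- by rewrite lee_fin mulr_ge0// mass_ge0.
rewrite integral_indic// setIT lte_mul_pinfty//.
  by rewrite lee_fin mulr_ge0// mass_ge0.
exact: leb_itv_lty.
Qed.

Let cut_bmeas K a b C u : jbounded K a b C -> bmeas (fun x => cut K a b (u, x)).
Proof.
move=> bK; split.
  exact: (measurableT_comp (measurable_cut bK) (measurable_pair1 u)).
by exists (`|C| * \1_(`[a, b]%classic) u) => x; exact: (cut_le bK).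
Qed.

Let cut_leb K a b C x : jbounded K a b C ->
  leb.-integrable setT (EFin \o (fun u => cut K a b (u, x))).
Proof.
move=> bK.
apply: (@le_integrable _ _ _ leb setT measurableT _
  (EFin \o (fun u => `|C| * \1_(`[a, b]%classic) u))).
- apply/measurable_EFinP.
  exact: (measurableT_comp (measurable_cut bK) (measurable_pair2 x)).
- by move=> u _; rewrite /= lee_fin (le_trans (cut_le bK _))//= ler_norm.
rewrite (_ : _ \o _ = (fun u => (`|C|%:E * (\1_(`[a, b]%classic) u : R)%:E)%E)).
  by apply: integrableZl => //; exact: integrable_indic_itv.
by apply/funext => u /=; rewrite EFinM.
Qed.

Let cut_pE K a b C p u : jbounded K a b C ->
  (\int[p]_x (cut K a b (u, x))%:E = (\int[p]_x cut K a b (u, x))%:E)%E.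
Proof.
move=> bK; rewrite /Rintegral fineK//.
exact: integrable_fin_num (bmeas_integrable p (cut_bmeas u bK)).
Qed.

Let cut_lebE K a b C x : jbounded K a b C ->
  (\int[leb]_u (cut K a b (u, x))%:E = (\int[leb]_(u in `[a, b]) K u x)%:E)%E.
Proof.
by move=> bK; rewrite -cutE /Rintegral fineK//; exact: integrable_fin_num (cut_leb x bK).
Qed.

Let cut_patch K a b p :
  (fun u => \int[p]_x cut K a b (u, x)) =
  (fun u => \int[p]_x K u x) \_ `[a, b]%classic.
Proof.
apply/funext => u; rewrite patchE /cut; case: ifPn => uab.
  by apply: eq_Rintegral => x _; rewrite /= indicE uab mul1r.
rewrite -[RHS](mul0r (mass p)) -Rint_cst; apply: eq_Rintegral => x _.
by rewrite /= indicE (negbTE uab) mul0r.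
Qed.

Lemma Rint_exchange p K a b C : jbounded K a b C ->
  \int[p]_x (\int[leb]_(u in `[a, b]) K u x) =
  \int[leb]_(u in `[a, b]) (\int[p]_x K u x).
Proof.
move=> bK; have ic := cut_integrable p bK.
have : (\int[leb]_u (\int[p]_x cut K a b (u, x))%:E =
    \int[p]_x (\int[leb]_(u in `[a, b]) K u x)%:E)%E.
  transitivity (\int[leb]_u \int[p]_x (cut K a b (u, x))%:E)%E.
    by apply: eq_integral => u _; rewrite (cut_pE p u bK).
  have /= -> := Fubini ic.
  by apply: eq_integral => x _; exact: (cut_lebE x bK).
move=> /(congr1 fine); rewrite -/(Rintegral _ _ _) -/(Rintegral _ _ _) => <-.
by rewrite [RHS]Rintegral_mkcond cut_patch.
Qed.

Lemma Rint_integrable_itv p K a b C : jbounded K a b C ->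
  leb.-integrable `[a, b] (EFin \o (fun u => \int[p]_x K u x)).
Proof.
move=> bK; have ic := cut_integrable p bK.
apply/(integrable_mkcond _ _).2 => //.
rewrite restrict_EFin -cut_patch.
apply: (eq_integrable _ _ _ _ (integrable_fubini_F ic)) => // u _.
exact: (cut_pE p u bK).
Qed.

Lemma normr_Rint_itv_le (f : R -> R) a b C : a <= b ->
  leb.-integrable `[a, b] (EFin \o f) -> (forall u, u \in `[a, b] -> `|f u| <= C) ->
  `|\int[leb]_(u in `[a, b]) f u| <= C * (b - a).
Proof.
move=> ab fi fC; rewrite (le_trans (le_normr_Rintegral _ _))//.
have -> : C * (b - a) = \int[leb]_(u in `[a, b]) C.
  rewrite Rintegral_cst//= lebesgue_measure_itv/= lte_fin.
  case: ltP => //= ba; suff -> : a = b by rewrite subrr.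
  by apply/le_anti; rewrite ab ba.
apply: le_Rintegral => //.
- by move/integrable_norm : fi.
- apply: measurable_bounded_integrable => //; first exact: leb_itv_lty.
  exact: bounded_cst.
Qed.

Lemma jbounded_integrable_itv K a b C x : jbounded K a b C ->
  leb.-integrable `[a, b] (EFin \o (K ^~ x)).
Proof.
move=> bK; apply/(integrable_mkcond _ _).2 => //.
apply: (eq_integrable _ _ _ _ (cut_leb x bK)) => // u _.
by rewrite /cut/= patchE indicE; case: ifP => _; rewrite ?mul1r ?mul0r.
Qed.

Lemma Rint_itv_bmeas K a b C p : a <= b -> jbounded K a b C ->
  bmeas (fun x => \int[leb]_(u in `[a, b]) K u x).
Proof.
move=> ab bK; have ic := cut_integrable p bK; split.
  apply/measurable_EFinP.
  apply: (eq_measurable_fun _ _ (measurable_fubini_G ic)) => x _.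
  exact: (cut_lebE x bK).
exists (C * (b - a)) => x; apply: normr_Rint_itv_le => //.
  exact: (jbounded_integrable_itv x bK).
by move=> u uab; exact: bK.2.
Qed.

Lemma Rint_itv_cvg0 (f_ : nat -> R -> R) a b C :
  (forall n, leb.-integrable `[a, b] (EFin \o f_ n)) ->
  (forall n u, u \in `[a, b] -> `|f_ n u| <= C) ->
  (forall u, u \in `[a, b] -> f_ n u @[n --> \oo] --> 0) ->
  \int[leb]_(u in `[a, b]) f_ n u @[n --> \oo] --> 0.
Proof.
move=> fi fC f0.
have [] := @dominated_convergence _ _ R leb `[a, b]%classic ltac:(by [])
  (fun n => EFin \o f_ n) (cst 0%:E) (cst C%:E).
- by move=> n; case/integrableP: (fi n).
- exact: measurable_cst.
- by apply: aeW => u uab; apply: cvg_EFin; [exact: nearW|exact: f0].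
- apply: measurable_bounded_integrable => //; first exact: leb_itv_lty.
  exact: bounded_cst.
- by apply: aeW => u n uab; rewrite lee_fin fC.
move=> _ _; rewrite integral0 => cv.
exact: (fine_cvg (f := fun n => (\int[leb]_(u in `[a, b]) (f_ n u)%:E)%E)).
Qed.

End fubini.

(** * Integrals against a difference of two finite measures *)

Section signed_integral.
Context d (X : measurableType d) (R : realType).
Implicit Types (p m : {finite_measure set X -> \bar R}) (h g : X -> R).
Local Notation leb := (@lebesgue_measure R).

Definition sint p m h : R := \int[p]_x h x - \int[m]_x h x.

Lemma sintD p m h g : bmeas h -> bmeas g ->
  sint p m (fun x => h x + g x) = sint p m h + sint p m g.
Proof.
move=> bh bg; rewrite /sint !RintegralD//; try exact: bmeas_integrable.
by ring.
Qed.

Lemma sintB p m h g : bmeas h -> bmeas g ->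
  sint p m (fun x => h x - g x) = sint p m h - sint p m g.
Proof.
move=> bh bg; rewrite /sint !RintegralB//; try exact: bmeas_integrable.
by ring.
Qed.

Lemma sintZ p m c h : bmeas h -> sint p m (fun x => c * h x) = c * sint p m h.
Proof.
move=> bh; rewrite /sint !RintegralZl//; try exact: bmeas_integrable.
by ring.
Qed.

Lemma sint_cst p m (c : R) : sint p m (fun=> c) = c * (mass p - mass m).
Proof. by rewrite /sint !Rint_cst -mulrBr. Qed.

Lemma sint_le p m h (c : R) : bmeas h -> (forall x, `|h x| <= c) ->
  `|sint p m h| <= c * (mass p + mass m).
Proof.
move=> bh hc; rewrite (le_trans (ler_normB _ _))// mulrDr.
by apply: lerD; exact: normr_Rint_le.
Qed.

Lemma sint_exchange p m (K : R -> X -> R) (a b C : R) : jbounded K a b C ->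
  sint p m (fun x => \int[leb]_(u in `[a, b]) K u x) =
  \int[leb]_(u in `[a, b]) sint p m (K u).
Proof.
move=> bK; rewrite /sint RintegralB//; try exact: Rint_integrable_itv bK.
by rewrite !(Rint_exchange _ bK).
Qed.

Lemma sint_integrable_itv p m (K : R -> X -> R) (a b C : R) : jbounded K a b C ->
  leb.-integrable `[a, b] (EFin \o (fun u => sint p m (K u))).
Proof.
move=> bK; rewrite (_ : EFin \o _ =
  (fun u => (\int[p]_x K u x)%:E - (\int[m]_x K u x)%:E)%E)//.
by apply: integrableB => //; exact: Rint_integrable_itv bK.
Qed.

(** Averaging preserves convergence to 0 of the integrals of a bounded kernel:
    exchange the integrals, then use dominated convergence in the parameter.
    The mass bound supplies the dominating constant. *)
Lemma sint_itv_cvg0 (p_ m_ : nat -> {finite_measure set X -> \bar R}) (B : R)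
    (K : R -> X -> R) (a b C : R) : a <= b ->
  (forall n, mass (p_ n) + mass (m_ n) <= B) ->
  jbounded K a b C ->
  (forall u, u \in `[a, b] -> sint (p_ n) (m_ n) (K u) @[n --> \oo] --> 0) ->
  sint (p_ n) (m_ n) (fun x => \int[leb]_(u in `[a, b]) K u x)
    @[n --> \oo] --> 0.
Proof.
move=> ab pmB bK K0.
under eq_fun do rewrite (sint_exchange _ _ bK).
apply: (@Rint_itv_cvg0 R _ a b (`|C| * B)) => //.
- by move=> n; exact: sint_integrable_itv bK.
- move=> n u uab; apply: (@le_trans _ _ (`|C| * (mass (p_ n) + mass (m_ n)))).
    apply: sint_le; first exact: (jbounded_bmeas bK).
    by move=> x; rewrite (le_trans (bK.2 u x uab))// ler_norm.
  by rewrite ler_wpM2l.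
Qed.

End signed_integral.

(** * Derivatives, primitives and trigonometric bounds *)

Section derivatives.
Context (R : realType).
Implicit Types (f g : R -> R) (x a b : R).

Lemma dcst x (c : R) : is_derive x 1 (fun=> c) 0.
Proof. exact: is_derive_cst. Qed.

Lemma did x : is_derive x 1 (fun y : R => y) 1.
Proof. exact: is_derive_id. Qed.

Lemma dD f g x a b : is_derive x 1 f a -> is_derive x 1 g b ->
  is_derive x 1 (fun y => f y + g y) (a + b).
Proof. by move=> df dg; exact: is_deriveD. Qed.

Lemma dN f x a : is_derive x 1 f a -> is_derive x 1 (fun y => - f y) (- a).
Proof. by move=> df; exact: is_deriveN. Qed.

Lemma dM f g x a b : is_derive x 1 f a -> is_derive x 1 g b ->
  is_derive x 1 (fun y => f y * g y) (f x * b + g x * a).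
Proof. by move=> df dg; exact: is_deriveM. Qed.

Lemma dcomp (h g : R -> R) x a b :
  is_derive (g x) 1 h a -> is_derive x 1 g b ->
  is_derive x 1 (fun y => h (g y)) (a * b).
Proof. by move=> dh dg; exact: (is_derive1_comp dh dg). Qed.

Lemma dcos g x b : is_derive x 1 g b ->
  is_derive x 1 (fun y => cos (g y)) (- sin (g x) * b).
Proof. by move=> dg; apply: dcomp; exact: is_derive_cos. Qed.

Lemma dsin g x b : is_derive x 1 g b ->
  is_derive x 1 (fun y => sin (g y)) (cos (g x) * b).
Proof. by move=> dg; apply: dcomp; exact: is_derive_sin. Qed.

Lemma dexp g x b : is_derive x 1 g b ->
  is_derive x 1 (fun y => expR (g y)) (expR (g x) * b).
Proof. by move=> dg; apply: dcomp; exact: is_derive_expR. Qed.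

Lemma datan g x b : is_derive x 1 g b ->
  is_derive x 1 (fun y => atan (g y)) ((1 + g x ^+ 2)^-1 * b).
Proof. by move=> dg; apply: dcomp; exact: is_derive1_atan. Qed.

Lemma derive_continuous f (f' : R -> R) :
  (forall x, is_derive x 1 f (f' x)) -> continuous f.
Proof.
move=> df x; apply: differentiable_continuous; apply/derivable1_diffP.
by case: (df x).
Qed.

Lemma FTC f F a b : a <= b -> continuous f ->
  (forall x, is_derive x 1 F (f x)) ->
  \int[lebesgue_measure]_(x in `[a, b]) f x = F b - F a.
Proof.
rewrite le_eqVlt => /orP[/eqP <- _ _|ab cf dF].
  by rewrite set_itv1 Rintegral_set1 subrr.
rewrite /Rintegral (@continuous_FTC2 _ f F)//.
- exact: continuous_subspaceT.
- have cF := derive_continuous dF; split.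
  + by move=> x _; case: (dF x).
  + exact/cvg_at_right_filter/cF.
  + exact/cvg_at_left_filter/cF.
- by move=> x _; rewrite derive1E; case: (dF x).
Qed.

(** A mean value inequality whose derivative bound is only required on the
    smallest symmetric interval containing both points; this is the form that
    yields the cubic estimate [sin_sub_le]. *)
Lemma mvt_le f (f' : R -> R) (K x y : R) :
  (forall z : R, is_derive z 1 f (f' z)) ->
  (forall z : R, `|z| <= Num.max `|x| `|y| -> `|f' z| <= K) ->
  `|f x - f y| <= K * `|x - y|.
Proof.
move=> df fK.
wlog xy : x y fK / x <= y.
  move=> H; have [|/ltW yx] := leP x y; first exact: H.
  by rewrite distrC (distrC x) H// maxC.
move: xy; rewrite le_eqVlt => /orP[/eqP ->|xy]; first by rewrite !subrr normr0 mulr0.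
have [z] := @MVT _ f f' _ _ xy (fun z _ => df z)
  (continuous_subspaceT (derive_continuous df)).
rewrite in_itv/= => /andP[xz zy] E.
rewrite distrC E normrM (distrC x) ler_wpM2r// fK// le_max.
have [z0|z0] := leP 0 z.
  by rewrite orbC (ger0_norm z0) ger0_norm ?(ltW zy)// (le_trans z0)// ltW.
rewrite (ltr0_norm z0) ltr0_norm ?lerN2 ?(ltW xz)//.
exact: lt_trans z0.
Qed.

End derivatives.

Ltac deriv := repeat first [ match goal with H : _ |- _ => exact: H end |
  exact: did | exact: dcst | apply: dD | apply: dN |
  apply: dM | apply: dcos | apply: dsin | apply: dexp | apply: datan].
Ltac derive_eq :=
  notypeclasses refine (is_derive_eq (f' := _) _ _); [deriv|rewrite /GRing.scale/=].

Section trigonometry.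
Context (R : realType).
Implicit Types x y u z : R.

Lemma sin_lip x y : `|sin x - sin y| <= `|x - y|.
Proof.
rewrite -[leRHS]mul1r; by apply: (@mvt_le _ sin cos) => z _; exact: cos_max.
Qed.

Lemma cos_lip x y : `|cos x - cos y| <= `|x - y|.
Proof.
rewrite -[leRHS]mul1r; by apply: (@mvt_le _ cos (fun z => - sin z)) => z _; rewrite normrN sin_max.
Qed.

Lemma normr_sin_le x : `|sin x| <= `|x|.
Proof. by have := sin_lip x 0; rewrite sin0 !subr0. Qed.

Lemma onem_cosE x : 1 - cos x = 2 * sin (x / 2) ^+ 2.
Proof.
have Ex : x = x / 2 + x / 2 by field.
have := cos2Dsin2 (x / 2).
by rewrite [in cos x]Ex cosD; lra.
Qed.

Lemma onem_cos_ge0 x : 0 <= 1 - cos x.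
Proof. by rewrite subr_ge0 cos_le1. Qed.

Lemma onem_cos_le x : 1 - cos x <= x ^+ 2 / 2.
Proof.
rewrite onem_cosE (_ : x ^+ 2 / 2 = 2 * (x / 2) ^+ 2); last by field.
rewrite ler_wpM2l// -(real_normK (num_real (sin _))).
by rewrite -(real_normK (num_real (x / 2))) lerXn2r ?nnegrE// normr_sin_le.
Qed.

Lemma sin_sub_le x : `|sin x - x| <= `|x| ^+ 3.
Proof.
have df (z : R) : is_derive z 1 (fun y : R => sin y - y) (cos z - 1).
  by derive_eq; ring.
have := mvt_le df (K := x ^+ 2) (x := x) (y := 0).
rewrite sin0 !subr0 => H.
rewrite [leRHS](_ : _ = x ^+ 2 * `|x|); last first.
  by rewrite exprSr real_normK ?num_real.
apply: H => z; rewrite normr0 (max_idPl _)// => zx.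
rewrite distrC ger0_norm ?onem_cos_ge0// (le_trans (onem_cos_le _))//.
have : z ^+ 2 <= x ^+ 2.
  by rewrite -(real_normK (num_real z)) -(real_normK (num_real x)) lerXn2r ?nnegrE.
by have := sqr_ge0 z; lra.
Qed.

End trigonometry.

(** * Poisson kernels and the real part of the Levy kernel *)

Section kernels.
Context (R : realType).
Implicit Types x y u z t tau T : R.
Local Notation leb := (@lebesgue_measure R).

(** One primitive serves two purposes: l > 0 gives the Poisson kernel as a
    Laplace transform of cosines, and l = 0 with z != 0 gives the decay at
    infinity of averages of cosines. *)
Lemma Rint_expcos (l z c a b : R) : a <= b -> l ^+ 2 + z ^+ 2 != 0 ->
  \int[leb]_(u in `[a, b]) (expR (- (l * u)) * cos (u * z + c)) =
  (expR (- (l * b)) * (z * sin (b * z + c) - l * cos (b * z + c)) -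
   expR (- (l * a)) * (z * sin (a * z + c) - l * cos (a * z + c)))
  / (l ^+ 2 + z ^+ 2).
Proof.
move=> ab lz.
pose F u := expR (- (l * u)) * (z * sin (u * z + c) - l * cos (u * z + c)) / (l ^+ 2 + z ^+ 2).
have dF (u : R) : is_derive u 1 F (expR (- (l * u)) * cos (u * z + c)).
  by rewrite /F; derive_eq; field.
rewrite (FTC ab _ dF); first by rewrite /F mulrBl.
apply: (@derive_continuous _ _ (fun u => expR (- (l * u)) * (- sin (u * z + c) * z)
  + cos (u * z + c) * (expR (- (l * u)) * - l))) => u.
by derive_eq; ring.
Qed.

Lemma Rint_poisson (e x a b : R) : 0 < e -> a <= b ->
  \int[leb]_(y in `[a, b]) (e / (e ^+ 2 + (x - y) ^+ 2)) =
  atan ((b - x) / e) - atan ((a - x) / e).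
Proof.
move=> e0 ab.
have den y : e ^+ 2 + (x - y) ^+ 2 != 0.
  by rewrite gt_eqF// ltr_wpDr ?sqr_ge0// exprn_gt0.
have e1 : e != 0 by rewrite gt_eqF.
have dF (y : R) : is_derive y 1 (fun y => atan ((y - x) / e)) (e / (e ^+ 2 + (x - y) ^+ 2)).
  derive_eq; field.
  by rewrite den e1.
rewrite (FTC ab _ dF)// => y.
apply: cvgM; first exact: cvg_cst.
apply: cvgV => //; apply: cvgD; first exact: cvg_cst.
by apply: cvgM; apply: cvgB => //; exact: cvg_cst.
Qed.

(** The part of the real kernel that vanishes as x tends to infinity; as functions
    of u, [coskerx], [sincx] and the cosine are successive derivatives,
    also at x = 0, which avoids any case distinction in the sequel. *)
Definition coskerx u x : R :=
  if x == 0 then u ^+ 2 / 2 else (1 - cos (u * x)) / x ^+ 2.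
Definition sincx u x : R := if x == 0 then u else sin (u * x) / x.

Lemma coskerx_ge0 u x : 0 <= coskerx u x.
Proof.
rewrite /coskerx; case: ifP => _; first by rewrite divr_ge0// sqr_ge0.
by rewrite divr_ge0 ?onem_cos_ge0 ?sqr_ge0.
Qed.

Lemma coskerx_le u x : coskerx u x <= u ^+ 2 / 2.
Proof.
rewrite /coskerx; case: eqP => [//|/eqP x0].
rewrite ler_pdivrMr ?exprn_even_gt0//= (le_trans (onem_cos_le _))//.
by rewrite exprMn mulrAC.
Qed.

Lemma normr_sincx_le u x : `|sincx u x| <= `|u|.
Proof.
rewrite /sincx; case: eqP => [//|/eqP x0].
by rewrite normrM normfV ler_pdivrMr ?normr_gt0// -normrM normr_sin_le.
Qed.

Lemma is_derive_coskerx u x : is_derive u 1 (coskerx ^~ x) (sincx u x).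
Proof.
rewrite /coskerx /sincx; case: eqP => [_|/eqP x0].
  have -> : (fun v : R => v ^+ 2 / 2) = (fun v => v * v * 2^-1) by [].
  by derive_eq; field.
by derive_eq; field.
Qed.

Lemma is_derive_sincx u x : is_derive u 1 (sincx ^~ x) (cos (u * x)).
Proof.
rewrite /sincx; case: eqP => [->|/eqP x0].
  by derive_eq; rewrite mulr0 cos0.
by derive_eq; field.
Qed.

(** This is (1 - cos (u x)) (1 + x^2) / x^2, extended by continuity at x = 0,
    because (1 + x^2) / x^2 = 1 + 1 / x^2. *)
Definition cosker u x : R := coskerx u x + (1 - cos (u * x)).

Lemma cosker_ge0 u x : 0 <= cosker u x.
Proof. by rewrite addr_ge0 ?coskerx_ge0 ?onem_cos_ge0. Qed.

Lemma cosker_le u x : cosker u x <= u ^+ 2 / 2 + 2.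
Proof.
by rewrite lerD ?coskerx_le//; have := cos_geN1 (u * x); lra.
Qed.

(** Over the whole half-line the average is exactly 1, since the Laplace
    transform of 1 - cos (u x) at 1 is x^2 / (1 + x^2), the inverse of the weight of
    the kernel.  Truncation at T costs an error uniform in x. *)
Lemma Rint_exp_cosker T x : 0 <= T ->
  `|\int[leb]_(u in `[0, T]) (expR (- u) * cosker u x) - 1| <=
    expR (- T) * (1 + T + T ^+ 2 / 2).
Proof.
move=> T0.
pose F u := - (expR (- u) * (1 + coskerx u x + sincx u x)).
have dk u := is_derive_coskerx u x; have ds u := is_derive_sincx u x.
have dF (u : R) : is_derive u 1 F (expR (- u) * cosker u x).
  by rewrite /F /cosker; derive_eq; ring.
rewrite (FTC T0 _ dF); last first.
  apply: (@derive_continuous _ _ (fun u => expR (- u) * (sincx u x + sin (u * x) * x) +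
    cosker u x * (expR (- u) * -1))) => u.
  by rewrite /cosker; derive_eq; ring.
have k0 : coskerx 0 x = 0.
  by rewrite /coskerx; case: ifP => _; rewrite ?mul0r ?cos0 ?subrr ?mul0r// expr0n mul0r.
have s0 : sincx 0 x = 0.
  by rewrite /sincx; case: ifP => // _; rewrite mul0r sin0 mul0r.
rewrite {2}/F k0 s0 oppr0 expR0 !addr0 mul1r opprK addrK /F normrN normrM.
rewrite ger0_norm ?expR_ge0// ler_wpM2l ?expR_ge0//.
rewrite (le_trans (ler_normD _ _))//.
have := normr_sincx_le T x; rewrite (ger0_norm T0) => hs.
have := coskerx_le T x => hk.
by rewrite ger0_norm ?addr_ge0 ?coskerx_ge0//; lra.
Qed.

End kernels.

(** * Subsequences *)

Section subsequences.
Implicit Types (s r : nat -> nat).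

Lemma subseq_index_ge s : subseq_index s -> forall n, (n <= s n)%N.
Proof.
move=> ss; elim=> // n IH; exact: leq_ltn_trans IH (ss _ _ (ltnSn n)).
Qed.

Lemma subseq_index_comp s r : subseq_index s -> subseq_index r ->
  subseq_index (s \o r).
Proof. by move=> ss sr m n mn; apply: ss; exact: sr. Qed.

Lemma subseq_near s (P : nat -> Prop) : subseq_index s ->
  (\forall n \near \oo, P n) -> \forall k \near \oo, P (s k).
Proof.
move=> ss [N _ PN]; exists N => // k /= Nk; apply: PN.
exact: leq_trans Nk (subseq_index_ge ss k).
Qed.

Lemma subseq_cvg (T : topologicalType) (u : nat -> T) (l : T) s :
  subseq_index s -> u n @[n --> \oo] --> l -> u (s k) @[k --> \oo] --> l.
Proof. by move=> ss ul A /ul; exact: subseq_near. Qed.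

(** If the sequence stayed at distance e from l infinitely often, the indices
    where it does would form a subsequence without any subsequence converging to l. *)
Lemma subseq_cvgr (R : realType) (u : nat -> R) (l : R) :
  (forall s, subseq_index s -> exists r, subseq_index r /\
    u (s (r k)) @[k --> \oo] --> l) ->
  u n @[n --> \oo] --> l.
Proof.
move=> H; apply/cvgrPdist_lt => e e0; apply: contrapT => nu.
have nxt (N : nat) : exists n, (N < n)%N /\ ~ (`|l - u n| < e).
  apply: contrapT => /forallNP nN; apply: nu; exists N.+1 => // n /= Nn.
  by apply: contrapT => ul; exact: (nN n).
have [f fP] := choice nxt.
pose s := fix s k := if k is k'.+1 then f (s k') else f 0%N.
have ss : subseq_index s.
  by apply: homo_ltn => [|k]; [exact: ltn_trans|exact: (fP _).1].
have bad k : ~ (`|l - u (s k)| < e) by case: k => [|k]; exact: (fP _).2.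
have [r [sr /cvgrPdist_lt/(_ e e0)[N _ /(_ N (leqnn N))]]] := H s ss.
exact: bad.
Qed.

Lemma near_seq_bounded (R : realType) (u : nat -> R) (K : R) :
  (\forall n \near \oo, u n <= K) -> exists K', forall n, u n <= K'.
Proof.
move=> [N _ uK]; exists (`|K| + \sum_(i < N) `|u i|) => n.
have [Nn|nN] := leqP N n.
  apply: (le_trans (uK n Nn)); apply: (le_trans (ler_norm _)).
  by rewrite lerDl sumr_ge0.
rewrite (bigD1 (Ordinal nN))//= addrCA (le_trans (ler_norm _))// lerDl.
by rewrite addr_ge0// sumr_ge0.
Qed.

End subsequences.

(** * Helly's selection theorem *)

Section helly.
Context (R : realType).
Implicit Types (H : R -> R) (a e : R).

Lemma ultrafilter_bounded_limit (U : set_system nat) (u : nat -> R) (B : R) :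
  UltraFilter U -> (forall n, `|u n| <= B) -> exists l : R, u n @[n --> U] --> l.
Proof.
move=> UU uB; have PU : ProperFilter U by exact: ultra_proper.
have [|l [_ cl]] := @segment_compact R (- B) B (u @ U) _.
  by apply: (@filterE _ U) => n /=; rewrite in_itv/= -ler_norml; exact: uB.
exists l => N Nl; have [//|UN] := in_ultra_setVsetC (u @^-1` N) UU.
by have [x [+ Nx]] := cl (~` N) N UN Nl.
Qed.

(** Instead of a diagonal extraction, take limits along one ultrafilter U finer
    than the Frechet filter: they exist at all points simultaneously.  For
    each k the indices at which the first k rationals are approximated within
    1 / (k + 1) belong to U, hence are unbounded, and a subsequence can be
    chosen one term after the other. *)
Lemma helly_selection (V : nat -> R -> R) (B : R) :
  (forall n, {homo V n : x y / x <= y}) -> (forall n x, `|V n x| <= B) ->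
  exists r, subseq_index r /\ exists H, {homo H : x y / x <= y} /\
    forall q : rat, V (r k) (ratr q) @[k --> \oo] --> H (ratr q).
Proof.
move=> Vnd VB.
have [U [UU ooU]] := ultraFilterLemma (eventually_filter).
have PU : ProperFilter U by exact: ultra_proper.
have lim x : exists l : R, V n x @[n --> U] --> l.
  by apply: (@ultrafilter_bounded_limit _ _ B).
have [H HP] := choice lim.
have Hnd : {homo H : x y / x <= y}.
  move=> x y xy; apply: (ler_cvg_to (HP x) (HP y)).
  by apply: filterE => n; exact: Vnd.
pose A k n := forall j q, (j <= k)%N -> unpickle j = Some q ->
  `|H (ratr q) - V n (ratr q)| < k.+1%:R^-1.
have UA k : U (A k).
  suff UA' m : U [set n | forall j q, (j <= m)%N -> unpickle j = Some q ->
      `|H (ratr q) - V n (ratr q)| < k.+1%:R^-1] by exact: UA'.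
  have k0 : 0 < k.+1%:R^-1 :> R by rewrite invr_gt0.
  have Uj j : U [set n | forall q, unpickle j = Some q ->
      `|H (ratr q) - V n (ratr q)| < k.+1%:R^-1].
    case E : (unpickle j : option rat) => [q|]; last by apply: filterE.
    have /cvgrPdist_lt/(_ _ k0) := HP (ratr q).
    by apply: filterS => n Hn _ [<-].
  elim: m => [|m IH].
    by apply: filterS (Uj 0%N) => n Hn j q; rewrite leqn0 => /eqP ->; exact: Hn.
  apply: filterS2 IH (Uj m.+1) => n Hn Hm j q.
  by rewrite leq_eqVlt => /orP[/eqP ->|]; [exact: Hm|exact: Hn].
have nxt (kN : nat * nat) : exists n, (kN.2 < n)%N /\ A kN.1 n.
  have : U (A kN.1 `&` [set n | (kN.2 < n)%N]).
    by apply: filterI => //; apply: ooU; exists kN.2.+1.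
  by move=> /filter_ex[n [An kn]]; exists n.
have [f fP] := choice nxt.
pose r := fix r k := if k is k'.+1 then f (k, r k') else f (0%N, 0%N).
have Ar k : A k (r k).
  by case: k => [|k]; [exact: (fP (0%N, 0%N)).2|exact: (fP (k.+1, r k)).2].
exists r; split.
  by apply: homo_ltn => [|k]; [exact: ltn_trans|exact: (fP (_, _)).1].
exists H; split=> // q; apply/cvgrPdist_lt => e e0.
have : \forall k \near \oo, k.+1%:R^-1 < e by exact: near_infty_natSinv_lt (PosNum e0).
have : \forall k \near \oo, (pickle q <= k)%N by exact: nbhs_infty_ge.
apply: filterS2 => k qk ke; apply: lt_trans ke.
by apply: (Ar k (pickle q)) => //; exact: pickleK.
Qed.

End helly.

Section continuity_points.
Context (R : realType).

Lemma countable_avoid (D : set R) (a b : R) : countable D -> a < b ->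
  exists x, a < x < b /\ ~ D x.
Proof.
move=> cD ab; apply: contrapT => /forallNP nD.
have sub : `]a, b[%classic `<=` D.
  move=> x /=; rewrite in_itv/= => xab; apply: contrapT => Dx.
  by apply: (nD x).
have := countable_lebesgue_measure0 (sub_countable (subset_card_le sub) cD).
by rewrite lebesgue_measure_itv/= lte_fin ab -EFinB => -[] /eqP; rewrite subr_eq0 gt_eqF.
Qed.

(** Off the countable set of jumps of H the endpoints of an interval can be
    enclosed between rationals across which H hardly increases; rationals are
    where Helly's theorem controls the distribution functions. *)
Lemma monotone_small_increments (H : R -> R) : {homo H : x y / x <= y} ->
  exists D : set R, countable D /\ forall a, ~ D a -> forall e : R, 0 < e ->
    exists q1 q2 : rat, ratr q1 < a < ratr q2 /\ H (ratr q2) - H (ratr q1) < e.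
Proof.
move=> Hnd; exists (discontinuity H); split.
  have -> : discontinuity H = \bigcup_(n in @setT nat)
      [set x : R | (x \in `](- n%:R), n%:R[) /\ discontinuity H x].
    apply/seteqP; split => [x dx|x [n _ [_ //]]].
    exists (Num.bound `|x|) => //; split => //.
    by rewrite in_itv/= -ltr_norml archi_boundP.
  apply: bigcup_countable => // n _; apply: discontinuity_countable.
  by move=> x y _ _; exact: Hnd.
move=> a Da e e0.
have cl : cvg (H x @[x --> a^'-]).
  apply: nondecreasing_at_left_is_cvgr.
    by near=> z => x y _ _; exact: Hnd.
  near=> z; exists (H a) => _ [y + <-]; rewrite set_itvE => /= /andP[_ /ltW].
  exact: Hnd.
have cr : cvg (H x @[x --> a^'+]).
  apply: nondecreasing_at_right_is_cvgr.
    by near=> z => x y _ _; exact: Hnd.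
  near=> z; exists (H a) => _ [y + <-]; rewrite set_itvE => /= /andP[/ltW + _].
  exact: Hnd.
have lr : lim (H x @[x --> a^'-]) = lim (H x @[x --> a^'+]).
  by apply/eqP/negPn/negP => lr; apply: Da.
have e2 : 0 < e / 2 by rewrite divr_gt0.
have [x1 [x1a Hx1]] : exists x, x < a /\ `|lim (H x @[x --> a^'-]) - H x| < e / 2.
  near (a^'-) => x; exists x; split; near: x.
    exact: nbhs_left_lt.
  by move/cvgrPdist_lt : cl; apply.
have [x2 [x2a Hx2]] : exists x, a < x /\ `|lim (H x @[x --> a^'+]) - H x| < e / 2.
  near (a^'+) => x; exists x; split; near: x.
    exact: nbhs_right_gt.
  by move/cvgrPdist_lt : cr; apply.
have [q1] := rat_in_itvoo x1a; rewrite in_itv/= => /andP[xq1 q1a].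
have [q2] := rat_in_itvoo x2a; rewrite in_itv/= => /andP[aq2 q2x].
exists q1, q2; split; first by rewrite q1a.
have := Hnd _ _ (ltW xq1); have := Hnd _ _ (ltW q2x).
by move: Hx1 Hx2; rewrite lr !ltr_norml => /andP[? ?] /andP[? ?]; lra.
Unshelve. all: by end_near. Qed.

(** Heine's theorem, in the asymmetric form where only one point is required to
    lie in the segment. *)
Lemma continuous_segment_modulus (phi : R -> R) (a b e : R) :
  continuous phi -> 0 < e -> exists2 d, 0 < d & forall x y,
    x \in `[a, b] -> `|x - y| < d -> `|phi x - phi y| <= e.
Proof.
move=> cphi e0; have e2 : 0 < e / 2 by rewrite divr_gt0.
have := (compact_near_coveringP _).1 (@segment_compact R a b).
move=> /(_ _ (0^'+ : set_system R) (fun d x => forall y, `|x - y| < d ->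
  `|phi x - phi y| <= e) _) [].
  move=> x xab.
  have /cvgrPdist_lt/(_ _ e2) := cphi x.
  move=> /nbhs_ballP[d /= d0 xd].
  exists (ball x (d / 2), [set t | t < d / 2]) => /=.
    split; first by apply: nbhsx_ballx; rewrite divr_gt0.
    by apply: nbhs_right_lt; rewrite divr_gt0.
  move=> [z t] /= [xz td] y zy.
  have Hz : `|phi x - phi z| < e / 2.
    by apply: xd => /=; rewrite /ball/= in xz *; move: xz; lra.
  have Hy : `|phi x - phi y| < e / 2.
    apply: xd; rewrite /ball/= in xz *.
    rewrite (_ : x - y = (x - z) + (z - y)); last by ring.
    by rewrite (le_lt_trans (ler_normD _ _))//; move: xz zy td; lra.
  rewrite (_ : phi z - phi y = (phi x - phi y) - (phi x - phi z)); last by ring.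
  by rewrite (le_trans (ler_normB _ _))//; move: Hz Hy; lra.
move=> d /= d0 H.
exists (d / 2); first by rewrite divr_gt0.
move=> x y xab xy; apply: (H (d / 2) _ _ x) => //=.
- by rewrite sub0r normrN gtr0_norm ?divr_gt0//; move: d0; rewrite /=; lra.
- by rewrite divr_gt0.
Qed.

End continuity_points.

(** * Sequences of signed measures with bounded mass *)

Section bounded_signed_measures.
Context (R : realType).
Local Notation T := (measurableTypeR R).
Local Notation leb := (@lebesgue_measure R).
Implicit Types (p m : {finite_measure set T -> \bar R}) (h g : R -> R).

Lemma continuous_bmeas (h : R -> R) (C : R) : continuous h ->
  (forall x, `|h x| <= C) -> @bmeas _ T R h.
Proof.
by move=> ch hC; split; [exact: continuous_measurable_fun|exists C].
Qed.

Lemma sint_dominated p m h g : @bmeas _ T R h -> @bmeas _ T R g ->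
  (forall x, `|h x| <= g x) ->
  `|sint p m h| <= \int[p]_x g x + \int[m]_x g x.
Proof.
move=> bh bg hg; rewrite (le_trans (ler_normB _ _))//.
by apply: lerD; rewrite (le_trans (le_normr_Rintegral _ (bmeas_integrable _ bh)))//;
  apply: le_Rint => //; exact: bmeas_norm.
Qed.

Lemma fine_measure_diff p (a b : R) : a <= b ->
  fine (p `]a, b]%classic) = fine (p `]-oo, b]%classic) - fine (p `]-oo, a]%classic).
Proof.
move=> ab.
have -> : `]-oo, b]%classic = `]-oo, a]%classic `|` `]a, b]%classic :> set T.
  by rewrite -itv_bndbnd_setU// bnd_simp.
rewrite measureU//; last first.
  apply/seteqP; split => // x [] /=; rewrite !in_itv/= => xa /andP[+ _].
  by rewrite ltNge xa.
by rewrite fineD ?fin_num_measure// addrAC subrr add0r.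
Qed.

Variables (P_ M_ : nat -> {finite_measure set T -> \bar R}) (B : R).
Hypothesis HB : forall n, mass (P_ n) + mass (M_ n) <= B.

Local Notation J := (fun n h => sint (P_ n) (M_ n) h).

Let B0 : 0 <= B.
Proof. by apply: le_trans (HB 0); rewrite addr_ge0 ?mass_ge0. Qed.

(** Bounded mass makes the integrals equicontinuous for the uniform norm. *)
Lemma sint_approx h : @bmeas _ T R h ->
  (forall e : R, 0 < e -> exists g, [/\ @bmeas _ T R g, (forall x, `|h x - g x| <= e) &
     J n g @[n --> \oo] --> 0]) ->
  J n h @[n --> \oo] --> 0.
Proof.
move=> bh H; apply/cvgrPdist_le => e e0.
have B1 : 0 < B + 1 by rewrite ltr_wpDl.
have [|g [bg hg Jg]] := H (e / 2 / (B + 1)); first by rewrite !divr_gt0.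
have e2 : 0 < e / 2 by rewrite divr_gt0.
have /cvgrPdist_le/(_ _ e2) := Jg; apply: filterS => n.
rewrite !sub0r !normrN => Jn.
have -> : J n h = J n (fun x => h x - g x) + J n g.
  by rewrite sintB// subrK.
rewrite (le_trans (ler_normD _ _))// [leRHS](splitr e) lerD//.
rewrite (le_trans (sint_le (P_ n) (M_ n) (bmeasB bh bg) hg))//.
rewrite mulrAC ler_pdivrMr// ler_wpM2l ?(ltW e2)// (le_trans (HB n))//.
by rewrite lerDl.
Qed.

Section from_fourier_transforms.
Hypothesis Jcos : forall t : R, J n (fun x => cos (t * x)) @[n --> \oo] --> 0.
Hypothesis Jsin : forall t : R, J n (fun x => sin (t * x)) @[n --> \oo] --> 0.

Let bcos (t c : R) : @bmeas _ T R (fun x => cos (t * x + c)).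
Proof.
apply: (@continuous_bmeas _ 1) => [|x]; last exact: cos_max.
by apply: derive_continuous => x; derive_eq.
Qed.

Let bsin (t : R) : @bmeas _ T R (fun x => sin (t * x)).
Proof.
apply: (@continuous_bmeas _ 1) => [|x]; last exact: sin_max.
by apply: derive_continuous => x; derive_eq.
Qed.

Let bcos0 (t : R) : @bmeas _ T R (fun x => cos (t * x)).
Proof. by have := bcos t 0; under eq_fun do rewrite addr0. Qed.

Lemma sint_cos_phase (t c : R) : J n (fun x => cos (t * x + c)) @[n --> \oo] --> 0.
Proof.
have -> : (fun n => J n (fun x => cos (t * x + c))) =
    (fun n => cos c * J n (fun x => cos (t * x)) - sin c * J n (fun x => sin (t * x))).
  apply/funext => n; rewrite -!sintZ// -sintB; [|exact: bmeasZ..].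
  by congr sint; apply/funext => x; rewrite cosD; ring.
rewrite -[X in _ --> X](_ : cos c * 0 - sin c * 0 = 0); last by ring.
by apply: cvgB; apply: cvgM => //; exact: cvg_cst.
Qed.

Lemma poisson_bounds (e z : R) : 0 < e -> `|z| / (e ^+ 2 + z ^+ 2) <= e^-1 /\
  e / (e ^+ 2 + z ^+ 2) <= e^-1.
Proof.
move=> e0; have den : 0 < e ^+ 2 + z ^+ 2 by rewrite ltr_wpDr ?sqr_ge0// exprn_gt0.
split; rewrite ler_pdivrMr// mulrC ler_pdivlMr//.
  rewrite -(real_normK (num_real z)).
  by have := sqr_ge0 (e - `|z|); have := sqr_ge0 e; have := sqr_ge0 `|z|; nra.
by have := sqr_ge0 z; rewrite -expr2; lra.
Qed.

Lemma poisson_continuous (e y : R) : 0 < e ->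
  continuous (fun x : R => e / (e ^+ 2 + (x - y) ^+ 2)).
Proof.
move=> e0 x; apply: cvgM; first exact: cvg_cst.
apply: cvgV; first by rewrite gt_eqF// ltr_wpDr ?sqr_ge0// exprn_gt0.
apply: cvgD; first exact: cvg_cst.
by apply: cvgM; apply: cvgB => //; exact: cvg_cst.
Qed.

Let bpoisson (e y : R) : 0 < e -> @bmeas _ T R (fun x => e / (e ^+ 2 + (x - y) ^+ 2)).
Proof.
move=> e0; apply: (@continuous_bmeas _ e^-1); first exact: poisson_continuous.
move=> x; have [_] := poisson_bounds (x - y) e0.
by rewrite ger0_norm// divr_ge0 ?(ltW e0)// addr_ge0 ?sqr_ge0.
Qed.

(** The Poisson kernel is an average of cosines, up to a truncation error that is
    uniform in x. *)
Lemma sint_poisson (e y : R) : 0 < e ->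
  J n (fun x => e / (e ^+ 2 + (x - y) ^+ 2)) @[n --> \oo] --> 0.
Proof.
move=> e0; apply: sint_approx; first exact: bpoisson.
move=> d d0.
have [S S0 HS] : exists2 S, 0 <= S & expR (- (e * S)) * (2 / e) <= d.
  exists ((2 / e) / d / e); first by rewrite !divr_ge0// ltW.
  rewrite expRN mulrC ler_pdivrMr ?expR_gt0//.
  have -> : e * (2 / e / d / e) = 2 / e / d by field; rewrite !gt_eqF.
  rewrite -ler_pdivrMl// mulrC; apply: le_trans (expR_ge1Dx _).
  by rewrite lerDr.
pose K (u x : R) := expR (- (e * u)) * cos (u * (x - y) + 0).
have cK (x : R) : continuous (K ^~ x).
  by rewrite /K => u; apply: derive_continuous => v; derive_eq.
have bK : @jbounded _ T R K 0 S 1.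
  split; last first.
    move=> u x; rewrite in_itv/= => /andP[u0 _].
    rewrite normrM (ger0_norm (expR_ge0 _)) mulr_ile1 ?expR_ge0 ?cos_max//.
    by rewrite -expR0 ler_expR oppr_le0 mulr_ge0// ltW.
  by rewrite /K; meas.
exists (fun x => \int[leb]_(u in `[0, S]) K u x); split.
- exact: (Rint_itv_bmeas (P_ 0) S0 bK).
- move=> x.
  rewrite Rint_expcos//; last first.
    by rewrite gt_eqF// ltr_wpDr ?sqr_ge0// exprn_gt0.
  set z := x - y; set E := expR (- (e * S)); set s := sin (S * z + 0).
  set c := cos (S * z + 0).
  have den : 0 < e ^+ 2 + z ^+ 2 by rewrite ltr_wpDr ?sqr_ge0// exprn_gt0.
  have den0 := lt0r_neq0 den.
  rewrite !mul0r mulr0 oppr0 expR0 add0r sin0 cos0.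
  rewrite [X in `|X|](_ : _ = - (E * (z * s - e * c) / (e ^+ 2 + z ^+ 2))); last by field.
  rewrite normrN normrM normfV (gtr0_norm den) normrM (ger0_norm (expR_ge0 _)).
  rewrite -mulrA (le_trans _ HS)// ler_wpM2l ?expR_ge0//.
  have [h1 h2] := poisson_bounds z e0.
  rewrite (_ : 2 / e = e^-1 + e^-1); last by field; rewrite gt_eqF.
  apply: le_trans (lerD h1 h2); rewrite -mulrDl ler_wpM2r ?invr_ge0 ?(ltW den)//.
  rewrite (le_trans (ler_normB _ _))// !normrM (gtr0_norm e0).
  by rewrite lerD// ler_piMr ?sin_max ?cos_max// ltW.
- apply: (sint_itv_cvg0 S0 HB bK) => u uS.
  have -> : (fun n => J n (K u)) =
      (fun n => expR (- (e * u)) * J n (fun x => cos (u * x + - (u * y)))).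
    apply/funext => n; rewrite -sintZ//; congr sint; apply/funext => x.
    by rewrite /K addr0 mulrBr.
  rewrite -(mulr0 (expR (- (e * u)))); apply: cvgM; first exact: cvg_cst.
  exact: sint_cos_phase.
Qed.

(** Integrate the Poisson kernels over their centers. *)
Lemma sint_atan (e a b : R) : 0 < e -> a <= b ->
  J n (fun x => atan ((b - x) / e) - atan ((a - x) / e)) @[n --> \oo] --> 0.
Proof.
move=> e0 ab.
have bK : @jbounded _ T R (fun y x => e / (e ^+ 2 + (x - y) ^+ 2)) a b e^-1.
  split; first by meas.
  move=> y x _; have [_] := poisson_bounds (x - y) e0.
  by rewrite ger0_norm// divr_ge0 ?(ltW e0)// addr_ge0 ?sqr_ge0.
have := sint_itv_cvg0 ab HB bK (fun y _ => sint_poisson y e0).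
by under eq_fun do under eq_fun do rewrite Rint_poisson//.
Qed.


(** The convolution of the indicator of ]a, b] with the Poisson kernel of scale
    e. *)
Definition smooth_indic (a b e x : R) : R :=
  pi^-1 * (atan ((b - x) / e) - atan ((a - x) / e)).

Lemma smooth_indic_itv (a b e x : R) : 0 < e -> a <= b ->
  0 <= smooth_indic a b e x <= 1.
Proof.
move=> e0 ab; have pi0 := @pi_gt0 R.
have h : atan ((a - x) / e) <= atan ((b - x) / e).
  by apply: le_atan; rewrite ler_wpM2r ?invr_ge0 ?(ltW e0)// lerD2r.
rewrite /smooth_indic mulr_ge0 ?invr_ge0 ?(ltW pi0) ?subr_ge0//=.
rewrite ler_pdivrMl// mulr1.
by have := atan_ltpi2 ((b - x) / e); have := atan_gtNpi2 ((a - x) / e); lra.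
Qed.

Lemma smooth_indic_approx (a b d eta : R) : a <= b -> 0 < d -> 0 < eta ->
  exists2 e, 0 < e & forall x, d <= `|x - a| -> d <= `|x - b| ->
    `|\1_(`]a, b]%classic) x - smooth_indic a b e x| <= eta.
Proof.
move=> ab d0 eta0; have pi0 := @pi_gt0 R.
have [A A0 HA] : exists2 A, 0 < A & pi / 2 - atan A <= eta * pi / 2.
  have ep : 0 < eta * pi / 2 by rewrite !mulr_gt0 ?invr_gt0.
  have /cvgrPdist_le/(_ _ ep) h := @cvgy_atan R.
  near (+oo%R : set_system R) => A; exists A; first by near: A; exact: nbhs_pinfty_gt.
  have : `|pi / 2 - atan A| <= eta * pi / 2 by near: A.
  by move=> /(le_trans (ler_norm _)).
exists (d / A); first by rewrite divr_gt0.
have hi y : d <= y -> eta * pi / 2 >= pi / 2 - atan (y / (d / A)).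
  move=> dy; apply: le_trans HA; rewrite lerD2l lerN2; apply: le_atan.
  by rewrite invf_div mulrCA ler_peMr ?(ltW A0)// ler_pdivlMr// mul1r.
have hi2 y : d <= y -> `|pi / 2 - atan (y / (d / A))| <= eta * pi / 2.
  move=> dy; rewrite ger0_norm ?hi// subr_ge0 ltW// atan_ltpi2//.
have lo2 y : y <= - d -> `|pi / 2 + atan (y / (d / A))| <= eta * pi / 2.
  by move=> dy; have := hi2 (- y); rewrite mulNr atanN opprK; apply; lra.
move=> x; rewrite /smooth_indic indicE mem_setE in_itv/=.
rewrite !ler_normr !opprB => xa xb.
set u := (b - x) / _; set v := (a - x) / _.
rewrite -(ler_pM2l pi0) -[X in X * `|_|](gtr0_norm pi0) -normrM mulrBr.
rewrite mulrA divff ?gt_eqF// mul1r.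
have [xa'|xa'] := leP d (a - x).
  have hv := hi2 _ xa'; have hu : `|pi / 2 - atan u| <= eta * pi / 2.
    by apply: hi2; lra.
  rewrite (_ : (a < x <= b) = false); last by apply/negbTE; lra.
  rewrite mulr0 (_ : 0 - _ = (pi / 2 - atan u) - (pi / 2 - atan v)); last by ring.
  by rewrite (le_trans (ler_normB _ _))//; lra.
have {}xa : d <= x - a by case/orP: xa => //; lra.
have hv : `|pi / 2 + atan v| <= eta * pi / 2 by apply: lo2; lra.
have [xb'|xb'] := leP d (b - x).
  have hu := hi2 _ xb'.
  rewrite (_ : (a < x <= b) = true); last by lra.
  rewrite mulr1 (_ : pi - _ = (pi / 2 - atan u) + (pi / 2 + atan v)); last by field.
  by rewrite (le_trans (ler_normD _ _))//; lra.
have {}xb : d <= x - b by case/orP: xb => //; lra.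
have hu : `|pi / 2 + atan u| <= eta * pi / 2 by apply: lo2; lra.
rewrite (_ : (a < x <= b) = false); last by apply/negbTE; lra.
rewrite mulr0 (_ : 0 - _ = (pi / 2 + atan v) - (pi / 2 + atan u)); last by ring.
by rewrite (le_trans (ler_normB _ _))//; lra.
Unshelve. all: by end_near. Qed.

Let cdf n (x : R) : R :=
  fine (P_ n `]-oo, x]%classic) + fine (M_ n `]-oo, x]%classic).

Let cdf_nd n : {homo cdf n : x y / x <= y}.
Proof.
move=> x y xy; have := fine_measure_diff (P_ n) xy; have := fine_measure_diff (M_ n) xy.
have p0 (p : {finite_measure set T -> \bar R}) (A : set T) : 0 <= fine (p A) by exact: fine_ge0.
by have := p0 (P_ n) `]x, y]%classic; have := p0 (M_ n) `]x, y]%classic; rewrite /cdf; lra.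
Qed.

Let cdf_le n x : `|cdf n x| <= B.
Proof.
have p0 (p : {finite_measure set T -> \bar R}) (A : set T) : 0 <= fine (p A) by exact: fine_ge0.
rewrite ger0_norm; last by rewrite addr_ge0.
have le_mass (p : {finite_measure set T -> \bar R}) : fine (p `]-oo, x]%classic) <= mass p.
  by apply: fine_le; rewrite ?fin_num_measure//; apply: le_measure; rewrite ?inE.
by apply: le_trans (HB n); apply: lerD; exact: le_mass.
Qed.

(** The indicator of ]a, b] and its Poisson smoothing differ by little outside
    neighbourhoods of a and b, and by at most 1 inside.  When a and b are
    continuity points of the Helly limit of the distribution functions of P_n + M_n, the total
    variation of those neighbourhoods is eventually small.  A subsequence is
    unavoidable: nearby atoms of opposite signs may wander. *)
Lemma sint_itv_cvg0_subseq s : subseq_index s ->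
  exists r, subseq_index r /\ exists D : set R, countable D /\
    forall a b, ~ D a -> ~ D b -> a <= b ->
      J (s (r k)) (\1_(`]a, b]%classic) : R -> R) @[k --> \oo] --> 0.
Proof.
move=> ss; have [r [sr [H [Hnd VH]]]] := @helly_selection R (fun k => cdf (s k)) B
  (fun k => @cdf_nd (s k)) (fun k => @cdf_le (s k)).
have [D [cD HD]] := monotone_small_increments Hnd.
exists r; split => //; exists D; split => // a b Da Db ab.
apply/cvgrPdist_le => e e0.
have e8 : 0 < e / 8 by rewrite divr_gt0.
have e16 : 0 < e / 16 by rewrite divr_gt0.
have B1 : 0 < B + 1 by rewrite ltr_wpDl.
have [q1 [q2 [/andP[q1a aq2] Ha]]] := HD a Da _ e8.
have [q3 [q4 [/andP[q3b bq4] Hb]]] := HD b Db _ e8.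
pose d := Num.min (Num.min (a - ratr q1) (ratr q2 - a)) (Num.min (b - ratr q3) (ratr q4 - b)).
have d0 : 0 < d by rewrite !lt_min !subr_gt0 q1a aq2 q3b.
have d1 : d <= a - ratr q1 by rewrite !ge_min lexx.
have d2 : d <= ratr q2 - a by rewrite !ge_min lexx orbT.
have d3 : d <= b - ratr q3 by rewrite !ge_min lexx !orbT.
have d4 : d <= ratr q4 - b by rewrite !ge_min lexx !orbT.
have eta0 : 0 < e / 4 / (B + 1) by rewrite !divr_gt0.
have [h h0 Hh] := smooth_indic_approx ab d0 eta0.
set eta := e / 4 / (B + 1) in eta0 Hh.
pose g := smooth_indic a b h.
pose I1 : R -> R := \1_(`]ratr q1, ratr q2]%classic).
pose I2 : R -> R := \1_(`]ratr q3, ratr q4]%classic).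
pose I0 : R -> R := \1_(`]a, b]%classic).
have bI0 : @bmeas _ T R I0 by exact: bmeas_indic.
have bI1 : @bmeas _ T R I1 by exact: bmeas_indic.
have bI2 : @bmeas _ T R I2 by exact: bmeas_indic.
have bg : @bmeas _ T R g.
  apply: (@continuous_bmeas _ 1).
    by apply: derive_continuous => x; rewrite /g /smooth_indic; derive_eq.
  by move=> x; have /andP[g0 g1] := smooth_indic_itv x h0 ab; rewrite ger0_norm.
have diff x : `|I0 x - g x| <= I1 x + I2 x + eta.
  have /andP[g0 g1] := smooth_indic_itv x h0 ab.
  have i0 (A : set R) : 0 <= (\1_A x : R) by rewrite indicE ler0n.
  have le1 : `|I0 x - g x| <= 1.
    by rewrite /I0 indicE /g ler_norml; case: (_ \in _) => /=; lra.
  have [xI|xI] := boolP (x \in `]ratr q1, ratr q2]%classic).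
    have -> : I1 x = 1 by rewrite /I1 indicE xI.
    by have := i0 `]ratr q3, ratr q4]%classic; rewrite -/I2; lra.
  have [xI'|xI'] := boolP (x \in `]ratr q3, ratr q4]%classic).
    have -> : I2 x = 1 by rewrite /I2 indicE xI'.
    by have := i0 `]ratr q1, ratr q2]%classic; rewrite -/I1; lra.
  apply: (@le_trans _ _ eta).
    move: xI xI'; rewrite !mem_setE !in_itv/= !negb_and -!leNgt -!ltNge => xI xI'.
    apply: Hh; rewrite ler_normr; apply/orP.
      by case/orP: xI => xI; [right|left]; lra.
    by case/orP: xI' => xI'; [right|left]; lra.
  by rewrite lerDr addr_ge0// i0.
have Jg : J (s (r k)) g @[k --> \oo] --> 0.
  apply: (@subseq_cvg _ (fun n => J n g) 0 (s \o r)).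
    exact: subseq_index_comp.
  have -> : (fun n => J n g) = (fun n => pi^-1 *
      J n (fun x => atan ((b - x) / h) - atan ((a - x) / h))).
    apply/funext => n; rewrite -sintZ//.
    apply: (@continuous_bmeas _ (2 * pi)).
      by apply: derive_continuous => x; derive_eq.
    move=> x; rewrite (le_trans (ler_normB _ _))// mulr_natl mulr2n.
    by rewrite lerD// ler_norml; have := @pi_gt0 R;
      [have := atan_ltpi2 ((b - x) / h); have := atan_gtNpi2 ((b - x) / h)
      |have := atan_ltpi2 ((a - x) / h); have := atan_gtNpi2 ((a - x) / h)]; lra.
  rewrite -(mulr0 pi^-1); apply: cvgM; first exact: cvg_cst.
  exact: sint_atan.
have e4 : 0 < e / 4 by rewrite divr_gt0.
have /cvgrPdist_le/(_ _ e4) near_g := Jg.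
have near_q q : \forall k \near \oo, `|H (ratr q) - cdf (s (r k)) (ratr q)| <= e / 32.
  by have /cvgrPdist_le := VH q; apply; rewrite divr_gt0.
near=> k.
have hg : `|0 - J (s (r k)) g| <= e / 4 by near: k.
have h1 : `|H (ratr q1) - cdf (s (r k)) (ratr q1)| <= e / 32 by near: k.
have h2 : `|H (ratr q2) - cdf (s (r k)) (ratr q2)| <= e / 32 by near: k.
have h3 : `|H (ratr q3) - cdf (s (r k)) (ratr q3)| <= e / 32 by near: k.
have h4 : `|H (ratr q4) - cdf (s (r k)) (ratr q4)| <= e / 32 by near: k.
set n := s (r k) in hg h1 h2 h3 h4 *.
suff : `|J n I0| <= e by rewrite sub0r normrN.
have -> : J n I0 = J n (fun x => I0 x - g x) + J n g by rewrite sintB// subrK.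
have bD : @bmeas _ T R (fun x => I1 x + I2 x + eta).
  by apply: bmeasD; [exact: bmeasD|exact: bmeas_cst].
have := sint_dominated (P_ n) (M_ n) (bmeasB bI0 bg) bD diff.
have E (p : {finite_measure set T -> \bar R}) : \int[p]_x (I1 x + I2 x + eta) =
    fine (p `]-oo, ratr q2]%classic) - fine (p `]-oo, ratr q1]%classic) +
    (fine (p `]-oo, ratr q4]%classic) - fine (p `]-oo, ratr q3]%classic)) + eta * mass p.
  rewrite RintegralD//; [|exact: bmeas_integrable (bmeasD _ _)|
    exact: bmeas_integrable (bmeas_cst _ _)].
  rewrite RintegralD//; [|exact: bmeas_integrable..].
  rewrite Rint_cst !Rint_indic// !fine_measure_diff// ltW//.
    exact: lt_trans q3b bq4.
  exact: lt_trans q1a aq2.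
rewrite !E => hD.
have etaB : eta * mass (P_ n) + eta * mass (M_ n) <= e / 4.
  rewrite -mulrDr /eta mulrAC ler_pdivrMr// ler_wpM2l ?(ltW e4)//.
  by apply: le_trans (HB n) _; rewrite lerDl.
move: hD hg h1 h2 h3 h4; rewrite /cdf sub0r normrN !ler_norml => hD hg h1 h2 h3 h4.
by lra.
Unshelve. all: by end_near. Qed.

End from_fourier_transforms.

Section from_intervals.
Variable D : set R.
Hypothesis cD : countable D.
Hypothesis JD : forall a b, ~ D a -> ~ D b -> a <= b ->
  J n (\1_(`]a, b]%classic) : R -> R) @[n --> \oo] --> 0.

(* Approximation of phi within e on ]a, y] by a function supported there whose
   integrals tend to 0; the support condition makes approximations on adjacent
   intervals additive. *)
Let step_approx (phi : R -> R) (e a y : R) := exists g, [/\ @bmeas _ T R g,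
  (forall x, ~~ (a < x <= y) -> g x = 0),
  (forall x, a < x <= y -> `|phi x - g x| <= e) &
  J n g @[n --> \oo] --> 0].

Let step_approx_extend phi e a y y' : a <= y -> y <= y' -> ~ D y -> ~ D y' ->
  (forall x, y < x <= y' -> `|phi x - phi y'| <= e) ->
  step_approx phi e a y -> step_approx phi e a y'.
Proof.
move=> ay yy' Dy Dy' he [g [bg g0 ge Jg]].
have bI : @bmeas _ T R (\1_(`]y, y']%classic) : R -> R) by exact: bmeas_indic.
exists (fun x => g x + phi y' * (\1_(`]y, y']%classic) x)); split.
- by apply: bmeasD => //; exact: bmeasZ.
- move=> x xay; rewrite indicE mem_setE in_itv/= g0; last by apply: contra xay; lra.
  rewrite (_ : (y < x <= y') = false); first by rewrite mulr0 addr0.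
  by apply/negbTE; apply: contra xay; lra.
- move=> x xay; rewrite indicE mem_setE in_itv/=.
  have [xy|yx] := leP x y.
    by rewrite andFb mulr0 addr0 ge//; lra.
  rewrite g0; last by rewrite negb_and -!leNgt -ltNge yx orbT.
  by rewrite (_ : (x <= y') = true) /= ?mulr1 ?add0r; [apply: he|]; lra.
have -> : (fun n => J n (fun x => g x + phi y' * (\1_(`]y, y']%classic) x))) =
    (fun n => J n g + phi y' * J n (\1_(`]y, y']%classic) : R -> R)).
  by apply/funext => n; rewrite sintD ?sintZ//; exact: bmeasZ.
rewrite -[X in _ --> X](_ : 0 + phi y' * 0 = 0); last by rewrite mulr0 addr0.
by apply: cvgD => //; apply: cvgM; [exact: cvg_cst|exact: JD].
Qed.

(** Approximate phi uniformly by step functions with breakpoints outside D.  The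
    induction on k advances by steps of length between d / 2 and d, d being a
    modulus of uniform continuity, which leaves room to avoid the countable set D. *)
Lemma sint_continuous_itv (phi : R -> R) (a b : R) : continuous phi ->
  ~ D a -> ~ D b -> a <= b ->
  J n (fun x => phi x * \1_(`]a, b]%classic) x) @[n --> \oo] --> 0.
Proof.
move=> cphi Da Db ab; apply: sint_approx.
  have [M HM] : exists M, forall x, x \in `[a, b] -> `|phi x| <= M.
    have /compact_bounded[M [_ HM]] : compact (phi @` `[a, b]%classic).
      apply: continuous_compact (@segment_compact R a b).
      exact: continuous_subspaceT.
    exists (`|M| + 1) => x xab; apply: HM; last by exists x.
    by rewrite (le_lt_trans (ler_norm _))// ltrDl.
  split.
    apply: measurable_funM; first exact: continuous_measurable_fun.
    exact: measurable_indic.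
  exists `|M| => x; rewrite indicE mem_setE in_itv/=.
  case: (boolP (a < x <= b)) => [/andP[ax xb]|_]; last by rewrite mulr0 normr0.
  by rewrite mulr1 (le_trans _ (ler_norm _))// HM// in_itv/= (ltW ax).
move=> e e0.
have [d d0 Hd] := continuous_segment_modulus a b cphi e0.
suff H k y : ~ D y -> a <= y <= b -> y <= a + k%:R * (d / 2) -> step_approx phi e a y.
  have d2 : 0 < d / 2 by rewrite divr_gt0.
  have hb : b <= a + (Num.bound ((b - a) / (d / 2)))%:R * (d / 2).
    rewrite -lerBlDl -ler_pdivrMr// ltW// archi_boundP//.
    by rewrite divr_ge0 ?(ltW d2)// subr_ge0.
  have [g [bg g0 ge Jg]] := H _ b Db ltac:(by rewrite ab lexx) hb.
  exists g; split => // x; rewrite indicE mem_setE in_itv/=.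
  case: (boolP (a < x <= b)) => xab; first by rewrite mulr1 ge.
  by rewrite mulr0 g0// subr0 normr0 ltW.
elim: k y => [|k IH] y Dy /andP[ay yb].
  rewrite mul0r addr0 => ya; have -> : y = a by apply/le_anti; rewrite ay ya.
  exists (fun=> 0); split => //; first exact: bmeas_cst.
    by move=> x; case: (ltgtP a x).
  under eq_fun do rewrite sint_cst mul0r.
  exact: cvg_cst.
rewrite -natr1 mulrDl mul1r => yk.
have close y' x : a <= y' -> y - d < y' -> y' < x <= y -> `|phi x - phi y| <= e.
  move=> ay' dy' /andP[y'x xy]; apply: Hd; first by rewrite in_itv/=; lra.
  by rewrite ler0_norm; lra.
have base : step_approx phi e a a.
  exists (fun=> 0); split => //; first exact: bmeas_cst.
    by move=> x; case: (ltgtP a x).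
  under eq_fun do rewrite sint_cst mul0r.
  exact: cvg_cst.
have [yad|yad] := ltP (y - a) d.
  apply: (step_approx_extend (y := a)) => // x; apply: close => //; lra.
have [y' [/andP[y'1 y'2] Dy']] := @countable_avoid R D (y - d) (y - d / 2) cD ltac:(lra).
apply: (step_approx_extend (y := y')) => //; [lra|lra| |].
- by move=> x; apply: close; lra.
- by apply: IH => //; lra.
Qed.

Definition vanishes_at_infinity (phi : R -> R) :=
  forall e, 0 < e -> exists A, forall x, A <= `|x| -> `|phi x| <= e.

Lemma sint_vanishing phi : continuous phi -> vanishes_at_infinity phi ->
  @bmeas _ T R phi -> J n phi @[n --> \oo] --> 0.
Proof.
move=> cphi vphi bphi; apply: sint_approx => // e e0.
have [A HA] := vphi e e0.
have [a [/andP[_ aA] Da]] := @countable_avoid R D (- `|A| - 1) (- `|A|) cD ltac:(lra).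
have [b [/andP[Ab _] Db]] := @countable_avoid R D (`|A|) (`|A| + 1) cD ltac:(lra).
have A0 : 0 <= `|A| := normr_ge0 A.
exists (fun x => phi x * \1_(`]a, b]%classic) x); split.
- apply: bmeasM => //; exact: bmeas_indic.
- move=> x; rewrite indicE mem_setE in_itv/=.
  case: (boolP (a < x <= b)) => xab; first by rewrite mulr1 subrr normr0 ltW.
  rewrite mulr0 subr0 HA// (le_trans (ler_norm A))// ler_normr.
  by move: xab; rewrite negb_and -leNgt -ltNge => /orP[?|?]; apply/orP; [right|left]; lra.
- by apply: sint_continuous_itv => //; lra.
Qed.

End from_intervals.
End bounded_signed_measures.

(** * Levy's continuity theorem *)

Section continuity_theorem.
Context (R : realType).
Local Notation T := (measurableTypeR R).
Implicit Types (p : {finite_measure set T -> \bar R}).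

Lemma tail_small p (e : R) : 0 < e ->
  exists N : nat, forall a b : R, a <= - N%:R -> N%:R <= b ->
    \int[p]_x (1 - \1_(`]a, b]%classic) x) <= e.
Proof.
move=> e0.
pose h n : R -> R := fun x => 1 - \1_(`](- n%:R : R), n%:R]%classic) x.
have bI (a b : R) : @bmeas _ T R (fun x => 1 - \1_(`]a, b]%classic) x).
  by apply: bmeasB; [exact: bmeas_cst|exact: bmeas_indic].
have : \int[p]_x h n x @[n --> \oo] --> \int[p]_x (0 : R).
  apply: (@Rint_bounded_cvg _ T R p h _ 1).
  - by move=> n; case: (bI (- n%:R) n%:R).
  - by move=> n x; rewrite /h indicE; case: (_ \in _); rewrite ?subrr ?subr0 ?normr0 ?normr1.
  move=> x; apply/cvgrPdist_le => d d0.
  exists (Num.bound `|x|) => // n /= xn.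
  have xn' : `|x| < n%:R.
    by rewrite (lt_le_trans (archi_boundP (normr_ge0 x)))// ler_nat.
  rewrite /h indicE mem_setE in_itv/= (_ : (- n%:R < x <= n%:R) = true).
    by rewrite subrr subr0 normr0 ltW.
  by move: xn'; rewrite ltr_norml => /andP[-> /ltW ->].
rewrite Rint_cst mul0r => /cvgrPdist_le/(_ _ e0)[N _ /(_ N (leqnn N))] HN.
exists N => a b aN Nb; apply: (@le_trans _ _ (\int[p]_x h N x)).
  apply: le_Rint; [exact: bI|exact: bI|move=> x]; rewrite /h lerD2l lerN2 !indicE !mem_setE !in_itv/=.
  case: (boolP (- N%:R < x <= N%:R)) => [/andP[Nx xN]|_]; last by rewrite ler0n.
  by rewrite (le_lt_trans aN Nx) (le_trans xN Nb).
by move: HN; rewrite sub0r normrN; apply: le_trans; exact: ler_norm.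
Qed.

(** Convergence on intervals along a subsequence handles the compact part; since
    the total masses agree, the convergence of the masses of ]a, b] also controls the
    tails. *)
Lemma levy_continuity (p_ : nat -> {finite_measure set T -> \bar R}) p :
  (forall n, mass (p_ n) = 1) -> mass p = 1 ->
  (forall t : R, \int[p_ n]_x cos (t * x) @[n --> \oo] --> \int[p]_x cos (t * x)) ->
  (forall t : R, \int[p_ n]_x sin (t * x) @[n --> \oo] --> \int[p]_x sin (t * x)) ->
  forall (h : R -> R) (C : R), continuous h -> (forall x, `|h x| <= C) ->
    \int[p_ n]_x h x @[n --> \oo] --> \int[p]_x h x.
Proof.
move=> p1_ p1 pcos psin h C ch hC.
have HB n : mass (p_ n) + mass p <= 2 by rewrite p1_ p1.
have J0 (g : R -> R) : (\int[p_ n]_x g x @[n --> \oo] --> \int[p]_x g x) ->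
    sint (p_ n) p g @[n --> \oo] --> 0.
  by move=> pg; rewrite -[X in _ --> X](subrr (\int[p]_x g x)); apply: cvgB => //; exact: cvg_cst.
suff : sint (p_ n) p h @[n --> \oo] --> 0.
  move=> Jh; rewrite (_ : (fun n => _) = (fun n => sint (p_ n) p h + \int[p]_x h x)).
    by rewrite -[X in _ --> X]add0r; apply: cvgD => //; exact: cvg_cst.
  by apply/funext => n; rewrite subrK.
apply: subseq_cvgr => s ss.
have [r [sr [D [cD HD]]]] := @sint_itv_cvg0_subseq R p_ (fun=> p) 2 HB
  (fun t => J0 _ (pcos t)) (fun t => J0 _ (psin t)) s ss.
exists r; split => //.
apply/cvgrPdist_le => e e0.
have C1 : 0 < C + 1 by rewrite ltr_wpDl// (le_trans _ (hC 0)).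
have e8 : 0 < e / 8 / (C + 1) by rewrite !divr_gt0.
have E (x : R) : (C + 1) * (4 * (x / 8 / (C + 1))) = x / 2.
  by field; rewrite gt_eqF.
have [N HN] := tail_small p e8.
have [a [/andP[_ aN] Da]] := @countable_avoid R D (- N%:R - 1) (- N%:R) cD ltac:(lra).
have [b [/andP[Nb _] Db]] := @countable_avoid R D N%:R (N%:R + 1) cD ltac:(lra).
have N0 : 0 <= N%:R :> R by [].
have ab : a <= b by lra.
have hp := HN a b (ltW aN) (ltW Nb).
pose I : R -> R := \1_(`]a, b]%classic).
have bI : @bmeas _ T R I by exact: bmeas_indic.
have bh : @bmeas _ T R h by exact: continuous_bmeas hC.
have bcI : @bmeas _ T R (fun x => 1 - I x) by apply: bmeasB => //; exact: bmeas_cst.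
have Jin : sint (p_ (s (r k))) p (fun x => h x * I x) @[k --> \oo] --> 0.
  exact: (@sint_continuous_itv R (fun k => p_ (s (r k))) (fun=> p) 2 (fun k => HB _) D cD HD).
have e2 : 0 < e / 2 by rewrite divr_gt0.
have /cvgrPdist_le/(_ _ e2) Hin := Jin.
have /cvgrPdist_le/(_ _ e8) HI := HD a b Da Db ab.
near=> k.
have hin : `|0 - sint (p_ (s (r k))) p (fun x => h x * I x)| <= e / 2 by near: k.
have hI : `|0 - sint (p_ (s (r k))) p I| <= e / 8 / (C + 1) by near: k.
set n := s (r k) in hin hI *.
have tail : sint (p_ n) p (fun x => 1 - I x) = - sint (p_ n) p I.
  by rewrite sintB//; [rewrite sint_cst p1_ p1; ring|exact: bmeas_cst].
have hout : `|sint (p_ n) p (fun x => h x * (1 - I x))| <=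
    \int[p_ n]_x (C * (1 - I x)) + \int[p]_x (C * (1 - I x)).
  apply: sint_dominated.
  - exact: bmeasM.
  - exact: bmeasZ.
  move=> x; rewrite normrM; have i0 : 0 <= 1 - I x.
    by rewrite /I indicE; case: (_ \in _); rewrite ?subrr ?subr0.
  by rewrite (ger0_norm i0) ler_wpM2r.
rewrite !RintegralZl// in hout; try exact: bmeas_integrable.
suff : `|sint (p_ n) p h| <= e by rewrite sub0r normrN.
have -> : sint (p_ n) p h =
    sint (p_ n) p (fun x => h x * I x) + sint (p_ n) p (fun x => h x * (1 - I x)).
  rewrite -sintD; [|exact: bmeasM..].
  by congr sint; apply/funext => x; ring.
have pn : \int[p_ n]_x (1 - I x) <= 2 * (e / 8 / (C + 1)).
  have hI' : - sint (p_ n) p I <= e / 8 / (C + 1).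
    by apply: (le_trans (ler_norm _)); move: hI; rewrite sub0r.
  have hp' : \int[p]_x (1 - I x) <= e / 8 / (C + 1) := hp.
  by move: tail; rewrite {1}/sint; lra.
rewrite (le_trans (ler_normD _ _))// [leRHS]splitr lerD//.
  by move: hin; rewrite sub0r normrN.
apply: (le_trans hout); rewrite -mulrDr.
apply: (@le_trans _ _ ((C + 1) * (4 * (e / 8 / (C + 1))))).
  apply: ler_pM.
  - by rewrite (le_trans _ (hC 0)).
  - by rewrite addr_ge0// Rintegral_ge0// => x _; rewrite /I indicE; case: (_ \in _); rewrite ?subrr ?subr0.
  - by rewrite lerDl.
  - by rewrite /I in pn *; lra.
by rewrite E.
Unshelve. all: by end_near. Qed.

End continuity_theorem.

(** * Differences of signed measures, and continuity in a parameter *)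

Section measure_sum.
Context d (X : measurableType d) (R : realType).
Implicit Types (p q : {finite_measure set X -> \bar R}).

(** A copy of [measure_add] that carries the structure of a finite measure. *)
Definition madd p q : set X -> \bar R := measure_add p q.

HB.instance Definition _ p q := Measure.on (madd p q).

Let madd_fin p q : fin_num_fun (madd p q).
Proof. by move=> U mU; rewrite /madd measure_addE fin_numD !fin_num_measure. Qed.

HB.instance Definition _ p q :=
  @Measure_isFinite.Build _ _ _ (madd p q) (@madd_fin p q).

Lemma mass_madd p q : mass (madd p q) = mass p + mass q.
Proof.
transitivity (fine (p setT + q setT)%E); last by rewrite fineD ?fin_num_measure.
by congr fine; exact: measure_addE.
Qed.

(** The difference of two signed measures, again as a pair of finite measures. *)
Lemma sint_madd p q p' q' (h : X -> R) : bmeas h ->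
  sint (madd p q') (madd q p') h = sint p q h - sint p' q' h.
Proof.
move=> bh; have E (a b : {finite_measure set X -> \bar R}) :
    \int[madd a b]_x h x = \int[a]_x h x + \int[b]_x h x.
  rewrite /Rintegral /madd integral_measure_add//; [|exact: bmeas_integrable..].
  by rewrite fineD//; exact: integrable_fin_num (bmeas_integrable _ bh).
by rewrite /sint !E; ring.
Qed.

Lemma Rint_param_continuous p (K : R -> X -> R) :
  (forall u, measurable_fun setT (K u)) -> (forall x, continuous (K ^~ x)) ->
  (forall A : R, exists C, forall u x, `|u| <= A -> `|K u x| <= C) ->
  continuous (fun u => \int[p]_x K u x).
Proof.
move=> mK cK bK t; have [C HC] := bK (`|t| + 1).
have tI : t \in (`]- (`|t| + 1), `|t| + 1[%classic : set R).
  by rewrite inE/= in_itv/= -ltr_norml ltrDl.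
have in_le u : `](- (`|t| + 1)), (`|t| + 1)[%classic u -> `|u| <= `|t| + 1.
  by rewrite /= in_itv/= -ltr_norml => /ltW.
apply: (@continuity_under_integral _ _ _ p K setT measurableT _ _ _ _ (cst C)
  _ _ t tI).
- by move=> u /in_le uI; apply: bmeas_integrable; split => //; exists C => x; exact: HC.
- by apply: aeW => x _ u _; exact: cK.
- by apply: bmeas_integrable; exact: bmeas_cst.
- by move=> u /in_le uI; apply: aeW => x _; exact: HC.
Qed.

End measure_sum.

(** * Continuous logarithms *)

Section logarithm.
Context (R : realType).
Implicit Types (r a eta : R).

(** In complex notation: if z1 = exp (r1 + i a1) and z2 = exp (r2 + i a2) are
    close, then z1 / z2 - 1 = (z1 - z2) / z2 is small as long as |z2| is bounded
    below. *)
Lemma polar_quotient_near1 (r1 a1 r2 a2 eta : R) :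
  `|expR r1 * cos a1 - expR r2 * cos a2| <= eta ->
  `|expR r1 * sin a1 - expR r2 * sin a2| <= eta ->
  `|expR (r1 - r2) * cos (a1 - a2) - 1| <= 2 * eta * expR (- r2) /\
  `|expR (r1 - r2) * sin (a1 - a2)| <= 2 * eta * expR (- r2).
Proof.
set dc := _ - _ => hc; set ds := _ - _ => hs.
have E2 : expR r2 * expR (- r2) = 1 by rewrite -expRD subrr expR0.
have cs := cos2Dsin2 a2.
have eta0 : 0 <= eta := le_trans (normr_ge0 _) hc.
have bound (x y : R) : `|x| <= 1 -> `|y| <= 1 ->
    `|expR (- r2) * (dc * x + ds * y)| <= 2 * eta * expR (- r2).
  move=> x1 y1; rewrite normrM (ger0_norm (expR_ge0 _)) mulrC ler_wpM2r ?expR_ge0//.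
  rewrite (le_trans (ler_normD _ _))// !normrM mulr_natl mulr2n.
  by rewrite lerD// -[leRHS]mulr1 ler_pM.
split.
  have -> : expR (r1 - r2) * cos (a1 - a2) - 1 =
      expR (- r2) * (dc * cos a2 + ds * sin a2).
    rewrite /dc /ds cosB expRD.
    have -> : (1 : R) = expR r2 * expR (- r2) * (cos a2 ^+ 2 + sin a2 ^+ 2) by rewrite E2 cs mulr1.
    by ring.
  by apply: bound; [exact: cos_max|exact: sin_max].
have -> : expR (r1 - r2) * sin (a1 - a2) =
    expR (- r2) * (dc * - sin a2 + ds * cos a2).
  by rewrite /dc /ds sinB expRD; ring.
by apply: bound; rewrite ?normrN; [exact: sin_max|exact: cos_max].
Qed.

Lemma atan_lip (x : R) : `|atan x| <= `|x|.
Proof.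
have := @mvt_le R atan (fun x => (1 + x ^+ 2)^-1) 1 x 0 (@is_derive1_atan R).
rewrite atan0 !subr0 mul1r; apply => z _.
by rewrite ger0_norm ?invr_ge0 ?addr_ge0 ?sqr_ge0// invf_le1 ?ltr_wpDr ?sqr_ge0// lerDl sqr_ge0.
Qed.

(** If exp (rho + i theta) stays near 1 on an interval, its cosine factor cannot
    vanish there, so a continuous theta starting at 0 never reaches +-pi / 2 and
    is given by the principal arctangent. *)
Lemma continuous_log_small (rho theta : R -> R) (t0 D eta : R) :
  continuous theta -> theta t0 = 0 -> eta <= 2^-1 ->
  (forall s, `|s - t0| <= D -> `|expR (rho s) * cos (theta s) - 1| <= eta /\
    `|expR (rho s) * sin (theta s)| <= eta) ->
  forall s, `|s - t0| <= D -> `|rho s| <= 2 * eta /\ `|theta s| <= 2 * eta.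
Proof.
move=> cth th0 eta2 H s sD.
have cos_pos r : `|r - t0| <= D -> 2^-1 <= expR (rho r) * cos (theta r).
  by move=> /H[+ _]; rewrite ler_norml; lra.
have pi2 : 0 < pi / 2 :> R by rewrite divr_gt0// pi_gt0.
have small : `|theta s| < pi / 2.
  rewrite ltNge; apply/negP => big.
  have cN : continuous (fun r => `|theta r|).
    by move=> r; apply: cvg_norm; exact: cth.
  have [c [cD]] : exists c, `|c - t0| <= D /\ `|theta c| = pi / 2.
    have [ts|st] := leP t0 s.
      have hv : Num.min `|theta t0| `|theta s| <= pi / 2 <= Num.max `|theta t0| `|theta s|.
        by rewrite th0 normr0 ge_min le_max (ltW pi2) big orbT.
      have [c + E] := IVT ts (continuous_subspaceT cN) hv.
      rewrite in_itv/= => /andP[tc cs]; exists c; split => //.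
      by apply: le_trans sD; rewrite !ger0_norm ?subr_ge0// lerB.
    have hv : Num.min `|theta s| `|theta t0| <= pi / 2 <= Num.max `|theta s| `|theta t0|.
      by rewrite th0 normr0 ge_min le_max (ltW pi2) big orbT.
    have [c + E] := IVT (ltW st) (continuous_subspaceT cN) hv.
    rewrite in_itv/= => /andP[sc ct]; exists c; split => //.
    by apply: le_trans sD; rewrite !ler0_norm ?subr_le0 ?(ltW st)// lerN2 lerB.
  move=> E; have := cos_pos c cD.
  suff -> : cos (theta c) = 0 by rewrite mulr0; lra.
  move: E; case: (ger0P (theta c)) => _ E; first by rewrite E cos_pihalf.
  by rewrite -[theta c]opprK cosN E cos_pihalf.
have [hc hs] := H s sD; have hp := cos_pos s sD.
have E0 := expR_gt0 (rho s).
have c0 : 0 < cos (theta s) by move: small; rewrite ltr_norml; exact: cos_gt0_pihalf.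
have eta0 : 0 <= eta := le_trans (normr_ge0 _) hc.
have hc1 : 1 - eta <= expR (rho s) * cos (theta s) by move: hc; rewrite ler_norml; lra.
have hc2 : expR (rho s) * cos (theta s) <= 1 + eta by move: hc; rewrite ler_norml; lra.
split.
  have up : expR (rho s) <= 1 + 2 * eta.
    have cs := cos2Dsin2 (theta s).
    have s1 : sin (theta s) ^+ 2 <= `|sin (theta s)|.
      by rewrite -real_normK ?num_real// expr2 ler_piMr// sin_max.
    have c1 : cos (theta s) ^+ 2 <= cos (theta s).
      by rewrite expr2 ler_piMr ?cos_le1// ltW.
    rewrite normrM gtr0_norm// in hs.
    have -> : expR (rho s) = expR (rho s) * cos (theta s) ^+ 2 + expR (rho s) * sin (theta s) ^+ 2.
      by rewrite -mulrDr cs mulr1.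
    have := ler_wpM2l (ltW E0) s1; have := ler_wpM2l (ltW E0) c1; lra.
  have lo : 1 - eta <= expR (rho s).
    by rewrite (le_trans hc1)// ler_piMr ?cos_le1// ltW.
  rewrite ler_norml; apply/andP; split; last by have := expR_ge1Dx (rho s); lra.
  have := expR_ge1Dx (- rho s); rewrite expRN => h.
  have : (expR (rho s))^-1 <= 1 + 2 * eta.
    rewrite -[leLHS]mul1r ler_pdivrMr//.
    apply: (@le_trans _ _ ((1 + 2 * eta) * (1 - eta))); first by nra.
    by rewrite ler_wpM2l//; lra.
  lra.
have thE : theta s = atan (tan (theta s)).
  by rewrite tanK// in_itv/= -ltr_norml.
rewrite thE (le_trans (atan_lip _))// /tan normrM normfV (gtr0_norm c0).
rewrite ler_pdivrMr//.
rewrite normrM gtr0_norm// in hs.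
have : `|sin (theta s)| * expR (rho s) <= 2 * eta * cos (theta s) * expR (rho s).
  by nra.
by rewrite ler_pM2r.
Qed.

End logarithm.

(** * Regularity of the Levy kernel *)

Section kernel_regularity.
Context (R : realType) (tau : R).
Hypothesis tau0 : 0 < tau.
Local Notation T := (measurableTypeR R).
Local Notation leb := (@lebesgue_measure R).
Implicit Types u x A : R.

(** At x = 0 the quotient is 0 by the convention on inverses, which is also its
    limit: the numerator is O(x^3) because its linear terms cancel. *)
Definition sinkerx u x : R := (sin (u * x) - u / tau * sin (tau * x)) / x ^+ 2.
Definition sinker u x : R := sinkerx u x + (sin (u * x) - u / tau * sin (tau * x)).

Lemma normr_sinkerx_le_lin u x :
  `|sinkerx u x| <= (`|u| ^+ 3 + `|u| * tau ^+ 2) * `|x|.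
Proof.
rewrite /sinkerx; have [->|x0] := eqVneq x 0.
  by rewrite expr0n/= invr0 mulr0 !normr0 mulr0.
have t0 : tau != 0 by rewrite gt_eqF.
have -> : sin (u * x) - u / tau * sin (tau * x) =
    (sin (u * x) - u * x) - u / tau * (sin (tau * x) - tau * x) by field.
rewrite normrM normfV normrX ler_pdivrMr ?exprn_gt0 ?normr_gt0//.
rewrite (le_trans (ler_normB _ _))//.
have h1 := sin_sub_le (u * x); have h2 := sin_sub_le (tau * x).
rewrite normrM in h1 *; rewrite [`|tau * x|]normrM (gtr0_norm tau0) in h2.
rewrite (_ : (_ + _) * _ * _ = (`|u| * `|x|) ^+ 3 + `|u| / tau * (tau * `|x|) ^+ 3); last by field.
rewrite lerD// !normrM normfV (gtr0_norm tau0) ler_wpM2l//.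
by rewrite divr_ge0// ltW.
Qed.

Lemma normr_sinkerx_le_quad u x : `|sinkerx u x| <= (1 + `|u| / tau) / x ^+ 2.
Proof.
rewrite /sinkerx normrM (ger0_norm (x := _^-1)) ?invr_ge0 ?sqr_ge0//.
rewrite ler_wpM2r ?invr_ge0 ?sqr_ge0// (le_trans (ler_normB _ _))//.
rewrite lerD ?sin_max// !normrM normfV (gtr0_norm tau0).
by rewrite ler_piMr ?sin_max// divr_ge0// ltW.
Qed.

Lemma normr_sinkerx_bounded A u x : `|u| <= A ->
  `|sinkerx u x| <= A ^+ 3 + A * tau ^+ 2 + (1 + A / tau).
Proof.
move=> uA; have A0 : 0 <= A := le_trans (normr_ge0 _) uA.
have a1 : 0 <= A ^+ 3 + A * tau ^+ 2.
  by rewrite addr_ge0 ?mulr_ge0 ?exprn_ge0// ltW.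
have a2 : 0 <= 1 + A / tau by rewrite addr_ge0// divr_ge0// ltW.
have [x1|x1] := leP `|x| 1.
  apply: (le_trans (normr_sinkerx_le_lin _ _)).
  apply: (@le_trans _ _ (A ^+ 3 + A * tau ^+ 2)); last by rewrite lerDl.
  rewrite -[leRHS]mulr1 ler_pM// ?addr_ge0 ?mulr_ge0 ?exprn_ge0 ?(ltW tau0)//.
  by rewrite lerD// ?lerXn2r// ler_wpM2r// exprn_ge0// ltW.
apply: (le_trans (normr_sinkerx_le_quad _ _)).
apply: (@le_trans _ _ (1 + A / tau)); last by rewrite lerDr.
rewrite -[leRHS]mulr1 ler_pM//.
- by rewrite addr_ge0// divr_ge0// ltW.
- by rewrite invr_ge0 sqr_ge0.
- by rewrite lerD2l ler_wpM2r// invr_ge0 ltW.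
- rewrite -real_normK ?num_real// invf_le1 ?exprn_gt0 ?(lt_trans ltr01)//.
  by rewrite expr_ge1 ?ltW// (lt_trans ltr01).
Qed.

Lemma coskerx_sub_le u x : `|coskerx u x - u ^+ 2 / 2| <= u ^+ 4 * x ^+ 2.
Proof.
rewrite /coskerx; have [->|x0] := eqVneq x 0.
  by rewrite subrr normr0 mulr_ge0 ?sqr_ge0// exprn_even_ge0//.
rewrite onem_cosE; set y := u * x / 2.
have h1 := sin_sub_le y; have h2 := normr_sin_le y.
have -> : 2 * sin y ^+ 2 / x ^+ 2 - u ^+ 2 / 2 =
    2 * ((sin y - y) * (sin y + y)) / x ^+ 2 by rewrite /y; field.
rewrite normrM (ger0_norm (x := _^-1)) ?invr_ge0 ?sqr_ge0//.
rewrite ler_pdivrMr ?exprn_even_gt0// normrM normr_nat normrM.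
have h3 : `|sin y + y| <= 2 * `|y|.
  by rewrite (le_trans (ler_normD _ _))//; lra.
apply: (@le_trans _ _ (2 * (`|y| ^+ 3 * (2 * `|y|)))).
  by rewrite ler_wpM2l// ler_pM.
rewrite (_ : 2 * _ = 4 * `|y| ^+ 4); last by ring.
rewrite -normrX (ger0_norm (x := y ^+ 4)); last by rewrite exprn_even_ge0//.
rewrite (_ : 4 * _ = u ^+ 4 * x ^+ 2 * x ^+ 2 / 4); last by rewrite /y; field.
rewrite ler_pdivrMr// ler_peMr//; last by lra.
by apply: mulr_ge0; [apply: mulr_ge0|]; rewrite ?sqr_ge0 ?exprn_even_ge0.
Qed.

Let divsq_continuous (f : R -> R) x : continuous f -> x != 0 ->
  {for x, continuous (fun y : R => f y / y ^+ 2)}.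
Proof.
move=> cf x0; apply: cvgM; first exact: cf.
apply: cvgV; first by rewrite sqrf_eq0.
by apply: cvgM.
Qed.

Let continuous_at0 (f : R -> R) (C : R) :
  (forall x, `|x| <= 1 -> `|f x - f 0| <= C * `|x|) -> {for 0, continuous f}.
Proof.
move=> fC; apply/cvgrPdist_le => /= e e0; have C1 : 0 < `|C| + 1 by rewrite ltr_wpDl.
apply/nbhs_ballP; exists (Num.min 1 (e / (`|C| + 1))) => /=.
  by rewrite lt_min ltr01 divr_gt0.
move=> x; rewrite /ball/= sub0r normrN lt_min => /andP[/ltW x1 /ltW].
rewrite ler_pdivlMr// mulrC => xe.
rewrite distrC (le_trans (fC x x1))// (le_trans _ xe)//.
by rewrite ler_wpM2r// (le_trans (ler_norm _))// lerDl.
Qed.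

Lemma coskerx_continuous u : continuous (coskerx u).
Proof.
move=> x; have [->|x0] := eqVneq x 0.
  apply: (@continuous_at0 _ (u ^+ 4)) => {}x x1.
  rewrite [coskerx u 0]/coskerx eqxx (le_trans (coskerx_sub_le u x))//.
  rewrite ler_wpM2l//; first by rewrite exprn_even_ge0//.
  by rewrite -real_normK ?num_real// expr2 ler_piMr.
apply: (@cvg_trans _ ((fun y => (1 - cos (u * y)) / y ^+ 2) @ x)).
  apply: near_eq_cvg; near=> y; rewrite /coskerx ifF//; apply/negbTE.
  by near: y; apply: cvgr_neq0 x0; exact: cvg_id.
rewrite /coskerx (negbTE x0).
apply: (@divsq_continuous (fun y => 1 - cos (u * y))) => //.
by apply: derive_continuous => y; derive_eq.
Unshelve. all: by end_near. Qed.

Lemma sinkerx_continuous u : continuous (sinkerx u).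
Proof.
move=> x; have [->|x0] := eqVneq x 0.
  apply: (@continuous_at0 _ (`|u| ^+ 3 + `|u| * tau ^+ 2)) => {}x _.
  rewrite [sinkerx u 0]/sinkerx expr0n/= invr0 mulr0 subr0.
  exact: normr_sinkerx_le_lin.
apply: (@divsq_continuous (fun y => sin (u * y) - u / tau * sin (tau * y))) => //.
by apply: derive_continuous => y; derive_eq.
Qed.

Let vanish_quad (f : R -> R) (C : R) : (forall x, x != 0 -> `|f x| <= C / x ^+ 2) ->
  vanishes_at_infinity f.
Proof.
move=> fC e e0; exists ((`|C| + 1) / e + 1) => x xA.
have C1 : 0 < `|C| + 1 by rewrite ltr_wpDl.
have Ce : 0 < (`|C| + 1) / e by rewrite divr_gt0.
have x0 : 0 < `|x| by apply: lt_le_trans xA; rewrite addr_gt0.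
rewrite (le_trans (fC x _)) -?normr_gt0// -real_normK ?num_real//.
rewrite ler_pdivrMr ?exprn_gt0// (le_trans (ler_norm _))//.
apply: (@le_trans _ _ (e * `|x|)).
  rewrite -ler_pdivrMl// mulrC (le_trans _ xA)// -[leLHS]addr0 lerD//.
  by rewrite ler_wpM2r ?invr_ge0 ?(ltW e0)// lerDl.
rewrite ler_wpM2l ?(ltW e0)// expr2 ler_peMl//.
by rewrite (le_trans _ xA)// lerDr ltW.
Qed.

Lemma coskerx_vanishes u : vanishes_at_infinity (coskerx u).
Proof.
apply: (@vanish_quad _ 2) => x x0; rewrite ger0_norm ?coskerx_ge0//.
rewrite /coskerx (negbTE x0) ler_wpM2r ?invr_ge0 ?sqr_ge0//.
by have := cos_geN1 (u * x); lra.
Qed.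

Lemma sinkerx_vanishes u : vanishes_at_infinity (sinkerx u).
Proof. by apply: (@vanish_quad _ (1 + `|u| / tau)) => x _; exact: normr_sinkerx_le_quad. Qed.

Lemma coskerx_bmeas u : @bmeas _ T R (coskerx u).
Proof.
apply: (continuous_bmeas (C := u ^+ 2 / 2) (@coskerx_continuous u)) => x.
by rewrite ger0_norm ?coskerx_ge0 ?coskerx_le.
Qed.

Lemma sinkerx_bmeas u : @bmeas _ T R (sinkerx u).
Proof.
by apply: (continuous_bmeas (@sinkerx_continuous u)) => x; exact: (@normr_sinkerx_bounded `|u|).
Qed.

Lemma cos_bmeas u : @bmeas _ T R (fun x => cos (u * x)).
Proof.
apply: (@continuous_bmeas _ _ 1) => [|x]; last exact: cos_max.
by apply: derive_continuous => x; derive_eq.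
Qed.

Lemma sin_bmeas u : @bmeas _ T R (fun x => sin (u * x)).
Proof.
apply: (@continuous_bmeas _ _ 1) => [|x]; last exact: sin_max.
by apply: derive_continuous => x; derive_eq.
Qed.

Lemma cosker_bmeas u : @bmeas _ T R (cosker u).
Proof.
apply: bmeasD; first exact: coskerx_bmeas.
by apply: bmeasB; [exact: bmeas_cst|exact: cos_bmeas].
Qed.

Lemma sinker_bmeas u : @bmeas _ T R (sinker u).
Proof.
apply: bmeasD; first exact: sinkerx_bmeas.
by apply: bmeasB; [exact: sin_bmeas|apply: bmeasZ; exact: sin_bmeas].
Qed.

Lemma measurable_coskerx2 :
  measurable_fun setT (fun z : R * T => coskerx z.1 (z.2 : R)).
Proof.
rewrite /coskerx; apply: measurable_fun_ifT; last by meas.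
  by apply: measurable_fun_eqr; meas.
by meas.
Qed.

Lemma measurable_sinkerx2 :
  measurable_fun setT (fun z : R * T => sinkerx z.1 (z.2 : R)).
Proof. by rewrite /sinkerx; meas. Qed.

Lemma measurable_cosker2 :
  measurable_fun setT (fun z : R * T => cosker z.1 (z.2 : R)).
Proof.
by rewrite /cosker; apply: measurable_funD; [exact: measurable_coskerx2|meas].
Qed.

Lemma normr_sinker_bounded A u x : `|u| <= A ->
  `|sinker u x| <= A ^+ 3 + A * tau ^+ 2 + 2 * (1 + A / tau).
Proof.
move=> uA; have A0 : 0 <= A := le_trans (normr_ge0 _) uA.
rewrite mulr_natl mulr2n addrA (le_trans (ler_normD _ _))// lerD//.
  exact: normr_sinkerx_bounded.
rewrite (le_trans (ler_normB _ _))// lerD ?sin_max// !normrM normfV (gtr0_norm tau0).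
by rewrite -[leRHS]mulr1 ler_pM ?sin_max ?divr_ge0 ?(ltW tau0)// ler_wpM2r// invr_ge0 ltW.
Qed.

Lemma continuous_sinker_Rint (p : {finite_measure set T -> \bar R}) :
  continuous (fun u => \int[p]_x sinker u x).
Proof.
apply: Rint_param_continuous.
- by move=> u; case: (sinker_bmeas u).
- by move=> x; rewrite /sinker /sinkerx; apply: derive_continuous => u; derive_eq.
by move=> A; eexists => u x; exact: normr_sinker_bounded.
Qed.

Lemma sinker_tau x : sinker tau x = 0.
Proof. by rewrite /sinker /sinkerx divff ?gt_eqF// mul1r subrr mul0r addr0. Qed.

Lemma sinker0 x : sinker 0 x = 0.
Proof. by rewrite /sinker /sinkerx !mul0r sin0 !subrr mul0r addr0. Qed.

Lemma sinkerxtau x : sinkerx tau x = 0.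
Proof. by rewrite /sinkerx divff ?gt_eqF// mul1r subrr mul0r. Qed.

(** The linear correction of the imaginary part and the constant of the real part
    disappear from symmetric second differences. *)
Lemma cosker_second_difference t u x :
  cosker (t + u) x + cosker (t - u) x - 2 * cosker t x =
  2 * (cos (t * x) * cosker u x).
Proof.
rewrite /cosker /coskerx; have [->|x0] := eqVneq x 0.
  by rewrite !mulr0 cos0; field.
by rewrite (mulrDl t u) (mulrBl x t u) cosD cosB; field.
Qed.

Lemma sinker_second_difference t u x :
  sinker (t + u) x + sinker (t - u) x - 2 * sinker t x =
  - (2 * (sin (t * x) * cosker u x)).
Proof.
have t0 : tau != 0 by rewrite gt_eqF.
rewrite /cosker /coskerx /sinker /sinkerx; have [->|x0] := eqVneq x 0.
  by rewrite !mulr0 sin0 expr0n/= invr0; ring.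
by rewrite (mulrDl t u) (mulrBl x t u) sinD sinB; field; rewrite t0 x0.
Qed.

(** Riemann-Lebesgue for a short interval of frequencies: it is a C_0 function of
    x although no single cosine is. *)
Lemma cos_average_vanishes (a b c : R) : a <= b ->
  let f (x : R) := \int[leb]_(u in `[a, b]) cos (u * x + c) in
  [/\ continuous f, vanishes_at_infinity f & @bmeas _ T R f].
Proof.
move=> ab f.
have ccos (x : R) : continuous (fun u : R => cos (u * x + c)).
  by apply: derive_continuous => u; derive_eq.
have ic (x : R) : leb.-integrable `[a, b] (EFin \o (fun u => cos (u * x + c))).
  apply: continuous_compact_integrable; first exact: segment_compact.
  exact/continuous_subspaceT/ccos.
pose A := Num.max `|a| `|b|.
have lip x y : `|f x - f y| <= A * (b - a) * `|x - y|.
  rewrite /f -RintegralB// mulrAC; apply: normr_Rint_itv_le => //.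
    rewrite (_ : EFin \o _ = (fun u => (cos (u * x + c))%:E - (cos (u * y + c))%:E)%E)//.
    by apply: integrableB => //; exact: ic.
  move=> u; rewrite in_itv/= => uab; rewrite (le_trans (cos_lip _ _))//.
  rewrite (_ : _ - _ = u * (x - y)); last by ring.
  have /andP[au ub] := uab; rewrite normrM ler_wpM2r// le_max; apply/orP.
  have [u0|u0] := leP 0 u.
    by right; rewrite ger0_norm// (le_trans ub)// ler_norm.
  by left; rewrite ltr0_norm// -(normrN a) (le_trans _ (ler_norm _))// lerN2.
have cf : continuous f.
  move=> x; apply/cvgrPdist_le => /= e e0.
  have A1 : 0 < A * (b - a) + 1.
    by rewrite ltr_wpDl// mulr_ge0 ?subr_ge0// le_max normr_ge0.
  near=> y; rewrite (le_trans (lip _ _))//.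
  have xy : `|x - y| <= e / (A * (b - a) + 1).
    by near: y; apply: cvgr_dist_le; [exact: cvg_id|rewrite divr_gt0].
  rewrite ler_pdivlMr// mulrC in xy; rewrite (le_trans _ xy)//.
  by rewrite ler_wpM2r// lerDl.
split => //.
  move=> e e0; exists (2 / e + 1) => x xe.
  have x0 : 0 < `|x| by apply: lt_le_trans xe; rewrite addr_gt0// divr_gt0.
  have xn0 : x != 0 by rewrite -normr_gt0.
  have -> : f x = (sin (b * x + c) - sin (a * x + c)) / x.
    transitivity (\int[leb]_(u in `[a, b]) (expR (- (0 * u)) * cos (u * x + c))).
      by apply: eq_Rintegral => u _; rewrite mul0r oppr0 expR0 mul1r.
    rewrite Rint_expcos// ?expr0n ?add0r ?sqrf_eq0//= !mul0r oppr0 expR0.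
    by field.
  rewrite normrM normfV ler_pdivrMr//.
  apply: (@le_trans _ _ 2).
    by rewrite (le_trans (ler_normB _ _))// mulr2n lerD// sin_max.
  rewrite -ler_pdivrMl// mulrC (le_trans _ xe)// lerDl//.
apply: (continuous_bmeas (C := 1 * (b - a)) cf) => x.
by apply: normr_Rint_itv_le => // u _; exact: cos_max.
Unshelve. all: by end_near. Qed.

End kernel_regularity.

(** * Characteristic functions under weak convergence *)

Section weak_convergence.
Context (R : realType).
Local Notation T := (measurableTypeR R).
Implicit Types (p q : {finite_measure set T -> \bar R}).

Definition measures_weak_cvg (p_ : nat -> {finite_measure set T -> \bar R}) p :=
  forall h : R -> R, continuous h -> (exists M, forall x, `|h x| <= M) ->
    \int[p_ n]_x h x @[n --> \oo] --> \int[p]_x h x.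

Definition equicontinuous_fourier (p_ : nat -> {finite_measure set T -> \bar R}) :=
  forall e : R, 0 < e -> exists2 d : R, 0 < d &
    \forall n \near \oo, forall u v, `|u - v| <= d ->
      `|\int[p_ n]_x cos (u * x) - \int[p_ n]_x cos (v * x)| <= e /\
      `|\int[p_ n]_x sin (u * x) - \int[p_ n]_x sin (v * x)| <= e.

(** Tightness in disguise: the increments of the transforms over a step d are at most
    int min (2, d |x|), a bounded continuous test function whose integral
    against the limit is small. *)
Lemma weak_cvg_equicontinuous (p_ : nat -> {finite_measure set T -> \bar R}) p :
  measures_weak_cvg p_ p ->
  equicontinuous_fourier p_.
Proof.
move=> pp e e0.
pose g (d x : R) := Num.min 2 (d * `|x|).
have g0 d x : 0 <= d -> 0 <= g d x by move=> d0; rewrite le_min mulr_ge0// ler0n.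
have cg d : continuous (g d).
  move=> x; apply: (@continuous_min _ _ (fun=> 2) (fun x => d * `|x|)); first exact: cvg_cst.
  by apply: cvgM; [exact: cvg_cst|apply: cvg_norm; exact: cvg_id].
have gM d x : 0 <= d -> `|g d x| <= 2.
  by move=> d0; rewrite ger0_norm ?g0// ge_min lexx.
have bg d : 0 <= d -> @bmeas _ T R (g d).
  by move=> d0; apply: (continuous_bmeas (C := 2) (@cg d)) => x; exact: gM.
have e2 : 0 < e / 2 by rewrite divr_gt0.
have [k Hk] : exists k : nat, \int[p]_x g k.+1%:R^-1 x <= e / 2.
  have : \int[p]_x g n.+1%:R^-1 x @[n --> \oo] --> \int[p]_x (0 : R).
    apply: (@Rint_bounded_cvg _ T R p (fun n => g n.+1%:R^-1) _ 2).
    - by move=> n; case: (@bg n.+1%:R^-1 _).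
    - by move=> n x; exact: gM.
    move=> x; apply: (@squeeze_cvgr _ _ _ _ (fun=> 0) (fun n => n.+1%:R^-1 * `|x|)).
    - by apply: nearW => n; rewrite g0// ge_min lexx orbT.
    - exact: cvg_cst.
    - rewrite -(mul0r `|x|); apply: cvgM; last exact: cvg_cst.
      exact: cvg_harmonic.
  rewrite Rint_cst mul0r => /cvgrPdist_le/(_ _ e2)[k _ /(_ k (leqnn k))] H.
  by exists k; move: H; rewrite sub0r normrN; apply: le_trans; exact: ler_norm.
set d := k.+1%:R^-1 in Hk; have d0 : 0 < d :> R by rewrite invr_gt0.
exists d => //.
have gb : exists M, forall x, `|g d x| <= M by exists 2 => x; apply: gM; exact: ltW.
have /cvgrPdist_le/(_ _ e2) := pp (g d) (@cg d) gb.
apply: filterS => n hn u v uv.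
have Hn : \int[p_ n]_x g d x <= e.
  by move: hn; rewrite ler_norml => /andP[+ _]; move: Hk; lra.
have main (f : R -> R) : (forall u, @bmeas _ T R (fun x => f (u * x))) ->
    (forall x, `|f x| <= 1) -> (forall x y, `|f x - f y| <= `|x - y|) ->
    `|\int[p_ n]_x f (u * x) - \int[p_ n]_x f (v * x)| <= e.
  move=> bf f1 flip; apply: le_trans Hn.
  rewrite -RintegralB//; [|exact: bmeas_integrable..].
  rewrite (le_trans (le_normr_Rintegral _ _))//.
    by apply: bmeas_integrable; exact: bmeasB.
  apply: le_Rint.
  - by apply: bmeas_norm; exact: bmeasB.
  - by apply: bg; exact: ltW.
  move=> x; rewrite le_min; apply/andP; split.
    by rewrite (le_trans (ler_normB _ _))// mulr2n lerD.
  by rewrite (le_trans (flip _ _))// -mulrBl normrM ler_wpM2r.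
split; apply: main.
- exact: cos_bmeas.
- exact: cos_max.
- exact: cos_lip.
- exact: sin_bmeas.
- exact: sin_max.
- exact: sin_lip.
Qed.

(** Pointwise convergence and equicontinuity, by compactness of [-A, A]. *)
Lemma weak_cvg_locally_uniform (p_ : nat -> {finite_measure set T -> \bar R}) p :
  measures_weak_cvg p_ p ->
  forall A e : R, 0 < e -> \forall n \near \oo, forall u, `|u| <= A ->
    `|\int[p_ n]_x cos (u * x) - \int[p]_x cos (u * x)| <= e /\
    `|\int[p_ n]_x sin (u * x) - \int[p]_x sin (u * x)| <= e.
Proof.
move=> pp A e e0.
have e3 : 0 < e / 3 by rewrite divr_gt0.
have [d1 d10 H1] := weak_cvg_equicontinuous pp e3.
have [|d2 d20 [N _ /(_ N (leqnn N)) H2]] := @weak_cvg_equicontinuous (fun=> p) p _ _ e3.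
  by move=> h _ _; exact: cvg_cst.
pose Q n u := `|\int[p_ n]_x cos (u * x) - \int[p]_x cos (u * x)| <= e /\
    `|\int[p_ n]_x sin (u * x) - \int[p]_x sin (u * x)| <= e.
have := (compact_near_coveringP _).1 (@segment_compact R (- A) A).
move=> /(_ _ \oo Q _) H.
have : \forall n \near \oo, `[- A, A] `<=` Q n.
  apply: H => u uA.
  have pc : \int[p_ n]_x cos (u * x) @[n --> \oo] --> \int[p]_x cos (u * x).
    apply: pp; last by exists 1 => x; exact: cos_max.
    by apply: derive_continuous => x; derive_eq.
  have ps : \int[p_ n]_x sin (u * x) @[n --> \oo] --> \int[p]_x sin (u * x).
    apply: pp; last by exists 1 => x; exact: sin_max.
    by apply: derive_continuous => x; derive_eq.
  have /cvgrPdist_le/(_ _ e3) Hc := pc; have /cvgrPdist_le/(_ _ e3) Hs := ps.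
  exists (ball u (Num.min d1 d2), [set n | [/\
      `|\int[p]_x cos (u * x) - \int[p_ n]_x cos (u * x)| <= e / 3,
      `|\int[p]_x sin (u * x) - \int[p_ n]_x sin (u * x)| <= e / 3 &
      forall u v, `|u - v| <= d1 ->
      `|\int[p_ n]_x cos (u * x) - \int[p_ n]_x cos (v * x)| <= e / 3 /\
      `|\int[p_ n]_x sin (u * x) - \int[p_ n]_x sin (v * x)| <= e / 3]]) => /=.
    split; first by apply: nbhsx_ballx; rewrite lt_min d10.
    by apply: filterS3 Hc Hs H1.
  move=> [v n] /= [uv [hc hs heq]].
  have [uv1 uv2] : `|u - v| <= d1 /\ `|u - v| <= d2.
    by move: uv; rewrite /ball/= lt_min => /andP[/ltW ? /ltW ?].
  have [a1 b1] := heq u v uv1; have [a2 b2] := H2 u v uv2.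
  have three (a b c' z : R) : `|a - b| <= e / 3 -> `|c' - a| <= e / 3 -> `|c' - z| <= e / 3 ->
      `|b - z| <= e.
    by rewrite !ler_norml; lra.
  split; first exact: three a1 hc a2.
  exact: three b1 hs b2.
apply: filterS => n Hn u uA; apply: Hn.
by rewrite /= in_itv/= -ler_norml.
Qed.

End weak_convergence.

(** * Exponents of quasi-infinitely divisible laws *)

Section exponents.
Context (R : realType) (tau : R).
Hypothesis tau0 : 0 < tau.
Local Notation T := (measurableTypeR R).
Implicit Types (p q F : {finite_measure set T -> \bar R}) (g t u : R).

(** Real and imaginary parts of the exponent of the characteristic function, for
    the signed measure p - q and the drift g. *)
Definition log_modulus p q u : R := - sint p q (cosker u).
Definition phase p q g u : R := u * g + sint p q (sinker tau u).

Definition quasi_id F p q g := forall u,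
  \int[F]_x cos (u * x) = expR (log_modulus p q u) * cos (phase p q g u) /\
  \int[F]_x sin (u * x) = expR (log_modulus p q u) * sin (phase p q g u).

Lemma normr_log_modulus_le p q u :
  `|log_modulus p q u| <= (u ^+ 2 / 2 + 2) * (mass p + mass q).
Proof.
rewrite normrN; apply: sint_le; first exact: cosker_bmeas.
by move=> x; rewrite ger0_norm ?cosker_ge0 ?cosker_le.
Qed.

Lemma phase_continuous p q g : continuous (phase p q g).
Proof.
move=> u; apply: cvgD; first by apply: cvgM; [exact: cvg_id|exact: cvg_cst].
by apply: cvgB; exact: continuous_sinker_Rint.
Qed.

Lemma phase0 p q g : phase p q g 0 = 0.
Proof.
rewrite /phase mul0r add0r.
have -> : sinker tau 0 = (fun=> 0) by apply/funext => x; rewrite sinker0.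
by rewrite sint_cst mul0r.
Qed.

Lemma phase_tau p q g : phase p q g tau = tau * g.
Proof.
rewrite /phase.
have -> : sinker tau tau = (fun=> 0) by apply/funext => x; rewrite sinker_tau.
by rewrite sint_cst mul0r addr0.
Qed.

(** The factor exp (- K) is a lower bound for the modulus of the limiting
    characteristic function on [-A, A]. *)
Lemma exponents_cvg (F_ P_ Q_ : nat -> {finite_measure set T -> \bar R})
    (g_ : nat -> R) F p q g :
  (forall n, quasi_id (F_ n) (P_ n) (Q_ n) (g_ n)) -> quasi_id F p q g ->
  measures_weak_cvg F_ F ->
  forall A e : R, 0 < e -> \forall n \near \oo, forall u, `|u| <= A ->
    `|log_modulus (P_ n) (Q_ n) u - log_modulus p q u| <= e /\
    `|phase (P_ n) (Q_ n) (g_ n) u - phase p q g u| <= e.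
Proof.
move=> q_ qF FF A e e0.
pose K := (A ^+ 2 / 2 + 2) * (mass p + mass q).
pose eta := Num.min 2^-1 (e / 2).
have eta0 : 0 < eta by rewrite lt_min invr_gt0 ltr0n divr_gt0.
have d0 : 0 < eta / 2 * expR (- K) by rewrite mulr_gt0 ?divr_gt0 ?expR_gt0.
have := weak_cvg_locally_uniform FF A d0; apply: filterS => n Hn u uA.
have h2 : 2 * eta <= e.
  have : eta <= e / 2 by rewrite ge_min lexx orbT.
  by lra.
suff [h3 h4] : `|log_modulus (P_ n) (Q_ n) u - log_modulus p q u| <= 2 * eta /\
    `|phase (P_ n) (Q_ n) (g_ n) u - phase p q g u| <= 2 * eta.
  by split; apply: le_trans h2.
apply: (@continuous_log_small R
  (fun u => log_modulus (P_ n) (Q_ n) u - log_modulus p q u)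
  (fun u => phase (P_ n) (Q_ n) (g_ n) u - phase p q g u) 0 A eta).
- by move=> v; apply: cvgB; exact: phase_continuous.
- by rewrite !phase0 subrr.
- by rewrite ge_min lexx.
- move=> s; rewrite subr0 => sA; have [] := Hn s sA.
  have [-> ->] := q_ n s; have [-> ->] := qF s => hc hs.
  have [h5 h6] := polar_quotient_near1 hc hs.
  have h7 : 2 * (eta / 2 * expR (- K)) * expR (- log_modulus p q s) <= eta.
    rewrite (_ : 2 * _ * _ = eta * (expR (- K) * expR (- log_modulus p q s))); last by field.
    rewrite -expRD ler_piMr ?(ltW eta0)// -expR0 ler_expR.
    rewrite -opprD oppr_le0.
    have := normr_log_modulus_le p q s; rewrite ler_norml => /andP[+ _].
    set X := (X in - X <= _); suff : X <= K by lra.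
    rewrite ler_wpM2r ?addr_ge0 ?mass_ge0//.
    rewrite lerD2r ler_wpM2r// -(real_normK (num_real s)) lerXn2r ?nnegrE//.
    by rewrite (le_trans _ sA).
  by split; [exact: le_trans h7|exact: le_trans h7].
- by rewrite subr0.
Qed.

(** Here the bounded masses keep the modulus of the characteristic functions at t
    above exp (- K), so that increments of the transforms control increments
    of their logarithms. *)
Lemma exponents_equicontinuous (F_ P_ Q_ : nat -> {finite_measure set T -> \bar R})
    (g_ : nat -> R) (B : R) :
  (forall n, quasi_id (F_ n) (P_ n) (Q_ n) (g_ n)) ->
  (forall n, mass (P_ n) + mass (Q_ n) <= B) -> equicontinuous_fourier F_ ->
  forall t e : R, 0 < e -> exists2 d, 0 < d &
    \forall n \near \oo, forall u, `|u - t| <= d ->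
      `|log_modulus (P_ n) (Q_ n) u - log_modulus (P_ n) (Q_ n) t| <= e /\
      `|phase (P_ n) (Q_ n) (g_ n) u - phase (P_ n) (Q_ n) (g_ n) t| <= e.
Proof.
move=> q_ HB eqF t e e0.
pose K := (t ^+ 2 / 2 + 2) * B.
pose eta := Num.min 2^-1 (e / 2).
have eta0 : 0 < eta by rewrite lt_min invr_gt0 ltr0n divr_gt0.
have d0 : 0 < eta / 2 * expR (- K) by rewrite mulr_gt0 ?divr_gt0 ?expR_gt0.
have [d dgt0 Hd] := eqF _ d0; exists d => //.
apply: filterS Hd => n Hn u ut.
have h2 : 2 * eta <= e.
  have : eta <= e / 2 by rewrite ge_min lexx orbT.
  by lra.
suff [h3 h4] : `|log_modulus (P_ n) (Q_ n) u - log_modulus (P_ n) (Q_ n) t| <= 2 * eta /\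
    `|phase (P_ n) (Q_ n) (g_ n) u - phase (P_ n) (Q_ n) (g_ n) t| <= 2 * eta.
  by split; apply: le_trans h2.
apply: (@continuous_log_small R
  (fun u => log_modulus (P_ n) (Q_ n) u - log_modulus (P_ n) (Q_ n) t)
  (fun u => phase (P_ n) (Q_ n) (g_ n) u - phase (P_ n) (Q_ n) (g_ n) t) t d eta).
- by move=> v; apply: cvgB; [exact: phase_continuous|exact: cvg_cst].
- by rewrite subrr.
- by rewrite ge_min lexx.
- move=> s sA; have [] := Hn s t sA.
  have [-> ->] := q_ n s; have [-> ->] := q_ n t => hc hs.
  have [h5 h6] := polar_quotient_near1 hc hs.
  have h7 : 2 * (eta / 2 * expR (- K)) * expR (- log_modulus (P_ n) (Q_ n) t) <= eta.
    rewrite (_ : 2 * _ * _ = eta * (expR (- K) * expR (- log_modulus (P_ n) (Q_ n) t)));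
      last by field.
    rewrite -expRD ler_piMr ?(ltW eta0)// -expR0 ler_expR.
    rewrite -opprD oppr_le0.
    have := normr_log_modulus_le (P_ n) (Q_ n) t; rewrite ler_norml => /andP[+ _].
    set X := (X in - X <= _); suff : X <= K by lra.
    rewrite ler_wpM2l//.
    by rewrite addr_ge0// divr_ge0// sqr_ge0.
  by split; [exact: le_trans h7|exact: le_trans h7].
- by [].
Qed.

End exponents.

(** * Removing the kernel by exponential averaging *)

Section exponential_averages.
Context (R : realType).
Local Notation T := (measurableTypeR R).
Local Notation leb := (@lebesgue_measure R).
Implicit Types (P Q : {finite_measure set T -> \bar R}).

Lemma exp_poly_small (e : R) : 0 < e ->
  exists2 A : R, 0 <= A & expR (- A) * (1 + A + A ^+ 2 / 2) <= e.
Proof.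
move=> e0; pose y := 8 / e; have y0 : 0 < y by rewrite divr_gt0.
exists (4 * y); first by rewrite mulr_ge0// ltW.
pose E := expR y; have Ey : 1 + y <= E := expR_ge1Dx y.
have E0 : 0 < E := expR_gt0 y.
have -> : expR (- (4 * y)) = (E ^+ 4)^-1.
  rewrite expRN (_ : 4 * y = y + y + y + y); last by ring.
  by rewrite !expRD; congr (_^-1); rewrite /E; ring.
apply: (@le_trans _ _ ((E ^+ 4)^-1 * (8 * E ^+ 2))).
  rewrite ler_wpM2l ?invr_ge0 ?exprn_ge0 ?(ltW E0)//.
  have : (1 + y) ^+ 2 <= E ^+ 2 by rewrite lerXn2r ?nnegrE ?(ltW E0)// addr_ge0// ltW.
  by nra.
rewrite (_ : _^-1 * _ = 8 / E ^+ 2); last by field; rewrite gt_eqF.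
rewrite ler_pdivrMr ?exprn_gt0//.
have -> : 8 = e * y by rewrite /y; field; rewrite gt_eqF.
rewrite ler_wpM2l ?(ltW e0)//.
by nra.
Qed.

Let K u x : R := expR (- u) * cosker u x.

Let K_bounded A u x : u \in `[0, A] -> 0 <= K u x <= A ^+ 2 / 2 + 2.
Proof.
rewrite in_itv/= => /andP[u0 uA]; rewrite mulr_ge0 ?expR_ge0 ?cosker_ge0//=.
apply: (@le_trans _ _ (cosker u x)).
  by rewrite ler_piMl ?cosker_ge0// -expR0 ler_expR oppr_le0.
rewrite (le_trans (cosker_le _ _))// lerD2r ler_wpM2r// lerXn2r ?nnegrE//.
exact: le_trans uA.
Qed.

Let K_jbounded A : @jbounded _ T R K 0 A (A ^+ 2 / 2 + 2).
Proof.
split; last by move=> u x /(@K_bounded A u x)/andP[? ?]; rewrite ger0_norm.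
by apply: measurable_funM; [by meas|exact: measurable_cosker2].
Qed.

(** Averaging [cosker] against exp (- u) over [0, A] gives at least 1 / 2
    everywhere. *)
Lemma mass_le_cosker (A C : R) P : 0 <= A ->
  expR (- A) * (1 + A + A ^+ 2 / 2) <= 2^-1 ->
  (forall u, 0 <= u <= A -> \int[P]_x cosker u x <= C) ->
  mass P <= 2 * (C * A).
Proof.
move=> A0 hA hC.
have bK := @K_jbounded A.
have : 2^-1 * mass P <= \int[P]_x (\int[leb]_(u in `[0, A]) K u x).
  rewrite -Rint_cst; apply: le_Rint.
  - exact: bmeas_cst.
  - exact: (Rint_itv_bmeas P A0 bK).
  move=> x; have := Rint_exp_cosker x A0; rewrite -/(K _ _) ler_norml => /andP[+ _].
  by move: hA; rewrite /K; lra.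
rewrite (Rint_exchange P bK) => h.
suff : \int[leb]_(u in `[0, A]) (\int[P]_x K u x) <= C * (A - 0) by lra.
apply: (le_trans (ler_norm _)); apply: normr_Rint_itv_le => //.
  exact: (Rint_integrable_itv P bK).
move=> u uA; have /= := uA; rewrite in_itv/= => /andP[u0 uA'].
rewrite RintegralZl//; last by apply: bmeas_integrable; exact: cosker_bmeas.
have c0 : 0 <= \int[P]_x cosker u x by apply: Rintegral_ge0 => x _; exact: cosker_ge0.
rewrite ger0_norm; last by rewrite mulr_ge0// expR_ge0.
apply: (le_trans _ (hC u _)); last by rewrite u0.
by rewrite ler_piMl// -expR0 ler_expR oppr_le0.
Qed.

(** Average the hypothesis over u against exp (- u): the weight [cosker u]
    averages to 1. *)
Lemma sint_cvg0_of_cosker (P_ M_ : nat -> {finite_measure set T -> \bar R})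
    (B : R) (f : R -> R) :
  (forall n, mass (P_ n) + mass (M_ n) <= B) ->
  @bmeas _ T R f -> (forall x, `|f x| <= 1) ->
  (forall u, sint (P_ n) (M_ n) (fun x => f x * cosker u x) @[n --> \oo] --> 0) ->
  sint (P_ n) (M_ n) f @[n --> \oo] --> 0.
Proof.
move=> HB bf f1 Hf; apply: (sint_approx HB) => // e e0.
have [A A0 hA] := exp_poly_small e0.
have bK := @K_jbounded A.
pose K' u x := f x * K u x.
have C0 : 0 <= A ^+ 2 / 2 + 2 by rewrite addr_ge0// divr_ge0// sqr_ge0.
have bK' : @jbounded _ T R K' 0 A (A ^+ 2 / 2 + 2).
  split; last first.
    move=> u x /(bK.2 u x) Kle; rewrite normrM -[leRHS]mul1r ler_pM//.

  apply: measurable_funM; last by case: bK.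
  by apply: (measurableT_comp bf.1); exact: measurable_snd.
have K'E x : \int[leb]_(u in `[0, A]) K' u x = f x * \int[leb]_(u in `[0, A]) K u x.
  rewrite RintegralZl//.
  apply: continuous_compact_integrable; first exact: segment_compact.
  apply: continuous_subspaceT; rewrite /K /cosker.
  apply: (@derive_continuous _ _ (fun u => expR (- u) * (sincx u x + sin (u * x) * x)
     + (coskerx u x + (1 - cos (u * x))) * (expR (- u) * -1))) => u.
  by have dk := is_derive_coskerx u x; derive_eq; ring.
exists (fun x => \int[leb]_(u in `[0, A]) K' u x); split.
- exact: (Rint_itv_bmeas (P_ 0) A0 bK').
- move=> x; rewrite K'E.
  rewrite (_ : f x - _ = - (f x * (\int[leb]_(u in `[0, A]) K u x - 1))); last by ring.
  rewrite normrN normrM (le_trans _ hA)// -[leRHS]mul1r ler_pM//.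
  exact: Rint_exp_cosker.
apply: (sint_itv_cvg0 A0 HB bK') => u uA.
have -> : (fun n => sint (P_ n) (M_ n) (K' u)) =
    (fun n => expR (- u) * sint (P_ n) (M_ n) (fun x => f x * cosker u x)).
  apply/funext => n; rewrite -sintZ; last by apply: bmeasM => //; exact: cosker_bmeas.
  by congr sint; apply/funext => x; rewrite /K' /K; ring.
by rewrite -(mulr0 (expR (- u))); apply: cvgM; [exact: cvg_cst|exact: Hf].
Qed.

End exponential_averages.

(** * Necessity *)

Section weak_implies_spectral.
Context (R : realType) (tau : R).
Hypothesis tau0 : 0 < tau.
Local Notation T := (measurableTypeR R).
Variables (F_ P_ Q_ : nat -> {finite_measure set T -> \bar R}) (g_ : nat -> R).
Variables (F p q : {finite_measure set T -> \bar R}) (g : R).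
Hypothesis qid_ : forall n, quasi_id tau (F_ n) (P_ n) (Q_ n) (g_ n).
Hypothesis qidF : quasi_id tau F p q g.
Hypothesis FF : measures_weak_cvg F_ F.

Let log_modulus_cvg u :
  log_modulus (P_ n) (Q_ n) u @[n --> \oo] --> log_modulus p q u.
Proof.
apply/cvgrPdist_le => e e0.
have := exponents_cvg tau0 qid_ qidF FF `|u| e0; apply: filterS => n /(_ u (lexx _))[h _].
by rewrite distrC.
Qed.

Let phase_cvg u : phase tau (P_ n) (Q_ n) (g_ n) u @[n --> \oo] --> phase tau p q g u.
Proof.
apply/cvgrPdist_le => e e0.
have := exponents_cvg tau0 qid_ qidF FF `|u| e0; apply: filterS => n /(_ u (lexx _))[_ h].
by rewrite distrC.
Qed.

(** The phase at tau is tau times the drift. *)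
Lemma drift_cvg : g_ n @[n --> \oo] --> g.
Proof.
have t0 : tau != 0 by rewrite gt_eqF.
have := @phase_cvg tau; under eq_fun do rewrite phase_tau//; rewrite phase_tau// => h.
have : tau^-1 * (tau * g_ n) @[n --> \oo] --> tau^-1 * (tau * g).
  by apply: cvgM => //; exact: cvg_cst.
by rewrite mulKf//; under eq_fun do rewrite mulKf//.
Qed.

Variable C : R.
Hypothesis QC : forall n, mass (Q_ n) <= C.

(** On [0, A] the integral of [cosker u] against P_n equals its integral against
    Q_n minus the logarithm of the modulus, and both are bounded. *)
Lemma positive_part_bounded : exists B, forall n, mass (P_ n) <= B.
Proof.
have half0 : 0 < 2^-1 :> R by rewrite invr_gt0.
have [A A0 hA] := exp_poly_small half0.
pose K := (A ^+ 2 / 2 + 2) * (mass p + mass q) + 1 + (A ^+ 2 / 2 + 2) * C.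
apply: (@near_seq_bounded R _ (2 * (K * A))).
have := exponents_cvg tau0 qid_ qidF FF A ltr01; apply: filterS => n Hn.
apply: mass_le_cosker => // u /andP[u0 uA].
have [|+ _] := Hn u; first by rewrite ger0_norm.
have h1 := normr_log_modulus_le p q u.
have h2 : `|\int[Q_ n]_x cosker u x| <= (u ^+ 2 / 2 + 2) * mass (Q_ n).
  apply: normr_Rint_le; first exact: cosker_bmeas.
  by move=> x; rewrite ger0_norm ?cosker_ge0 ?cosker_le.
have uA2 : u ^+ 2 / 2 + 2 <= A ^+ 2 / 2 + 2.
  by rewrite lerD2r ler_wpM2r// lerXn2r ?nnegrE.
have u2 : 0 <= u ^+ 2 / 2 + 2 by rewrite addr_ge0// divr_ge0// sqr_ge0.
have h3 : (u ^+ 2 / 2 + 2) * (mass p + mass q) <= (A ^+ 2 / 2 + 2) * (mass p + mass q).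
  by rewrite ler_wpM2r// addr_ge0 ?mass_ge0.
have h4 : (u ^+ 2 / 2 + 2) * mass (Q_ n) <= (A ^+ 2 / 2 + 2) * C.
  by rewrite ler_pM ?mass_ge0.
rewrite {1}/log_modulus /sint /K.
by move: h1 h2; rewrite !ler_norml; lra.
Qed.

Let J n h := sint (madd (P_ n) q) (madd (Q_ n) p) h.

(** Second differences of the exponents tend to 0, and they are the integrals of
    the exponentials weighted by [cosker u]. *)
Lemma signed_difference_fourier_cvg0 t :
  J n (fun x => cos (t * x)) @[n --> \oo] --> 0 /\
  J n (fun x => sin (t * x)) @[n --> \oo] --> 0.
Proof.
have [B HB] := positive_part_bounded.
have HJ n : mass (madd (P_ n) q) + mass (madd (Q_ n) p) <= B + mass q + (C + mass p).
  by rewrite !mass_madd; have := HB n; have := QC n; lra.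
have Jcos u : J n (cosker u) @[n --> \oo] --> 0.
  rewrite (_ : (fun n => J n (cosker u)) =
      (fun n => log_modulus p q u - log_modulus (P_ n) (Q_ n) u)); last first.
    by apply/funext => n; rewrite /J sint_madd ?/log_modulus; [ring|exact: cosker_bmeas].
  rewrite -(subrr (log_modulus p q u)).
  by apply: cvgB; [exact: cvg_cst|exact: log_modulus_cvg].
have Jsin u : J n (sinker tau u) @[n --> \oo] --> 0.
  rewrite (_ : (fun n => J n (sinker tau u)) =
      (fun n => phase tau (P_ n) (Q_ n) (g_ n) u - phase tau p q g u - u * (g_ n - g))); last first.
    by apply/funext => n; rewrite /J sint_madd ?/phase; [ring|exact: sinker_bmeas].
  rewrite -[X in _ --> X](_ : (phase tau p q g u - phase tau p q g u) - u * (g - g) = 0); last first.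
    by rewrite !subrr mulr0 subr0.
  apply: cvgB; first by apply: cvgB => //; exact: cvg_cst.
  apply: cvgM; first exact: cvg_cst.
  by apply: cvgB; [exact: drift_cvg|exact: cvg_cst].
split; apply: (sint_cvg0_of_cosker HJ).
- exact: cos_bmeas.
- by move=> x; exact: cos_max.
- move=> u; have -> : (fun n => sint (madd (P_ n) q) (madd (Q_ n) p)
        (fun x => cos (t * x) * cosker u x)) =
      (fun n => 2^-1 * (J n (cosker (t + u)) + J n (cosker (t - u)) - 2 * J n (cosker t))).
    apply/funext => n; rewrite /J -sintZ; last exact: cosker_bmeas.
    rewrite -sintD; [|exact: cosker_bmeas..].
    rewrite -sintB; [|by apply: bmeasD; exact: cosker_bmeas|by apply: bmeasZ; exact: cosker_bmeas].
    rewrite -sintZ; last first.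
      by apply: bmeasB; [apply: bmeasD|apply: bmeasZ]; exact: cosker_bmeas.
    by congr sint; apply/funext => x; rewrite cosker_second_difference; field.
  rewrite -[X in _ --> X](_ : 2^-1 * (0 + 0 - 2 * 0) = 0); last by ring.
  apply: cvgM; first exact: cvg_cst.
  by apply: cvgB; [apply: cvgD|apply: cvgM; [exact: cvg_cst|]]; exact: Jcos.
- exact: sin_bmeas.
- by move=> x; exact: sin_max.
- move=> u; have -> : (fun n => sint (madd (P_ n) q) (madd (Q_ n) p)
        (fun x => sin (t * x) * cosker u x)) =
      (fun n => - 2^-1 * (J n (sinker tau (t + u)) + J n (sinker tau (t - u))
         - 2 * J n (sinker tau t))).
    have bs v : @bmeas _ T R (sinker tau v) by exact: sinker_bmeas.
    apply/funext => n; rewrite /J -sintZ; last exact: bs.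
    rewrite -sintD; [|exact: bs..].
    rewrite -sintB; [|by apply: bmeasD; exact: bs|by apply: bmeasZ; exact: bs].
    rewrite -sintZ; last first.
      by apply: bmeasB; [apply: bmeasD|apply: bmeasZ]; exact: bs.
    by congr sint; apply/funext => x; rewrite sinker_second_difference//; field.
  rewrite -[X in _ --> X](_ : - 2^-1 * (0 + 0 - 2 * 0) = 0); last by ring.
  apply: cvgM; first exact: cvg_cst.
  by apply: cvgB; [apply: cvgD|apply: cvgM; [exact: cvg_cst|]]; exact: Jsin.
Qed.

End weak_implies_spectral.

(** * Sufficiency *)

Section equicontinuous_transforms.
Context (R : realType).
Local Notation T := (measurableTypeR R).
Local Notation leb := (@lebesgue_measure R).
Variables (P_ M_ : nat -> {finite_measure set T -> \bar R}) (B : R).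
Hypothesis HB : forall n, mass (P_ n) + mass (M_ n) <= B.
Variable D : set R.
Hypothesis cD : countable D.
Hypothesis JD : forall a b, ~ D a -> ~ D b -> a <= b ->
  sint (P_ n) (M_ n) (\1_(`]a, b]%classic) : R -> R) @[n --> \oo] --> 0.

(** Write V_n (u) for the integral of cos (u x + c) + k u x.  Its average over
    [t, t + d] tends to 0, the cosine contributing a function that vanishes at
    infinity; equicontinuity compares V_n (t) with that average.  The phase c covers
    cosines and sines at once. *)
Lemma sint_cvg0_of_equicontinuous (k : R -> R -> R) (c t C : R) :
  (forall u, @bmeas _ T R (k u)) -> @jbounded _ T R k t (t + 1) C ->
  (forall u, sint (P_ n) (M_ n) (k u) @[n --> \oo] --> 0) ->
  (forall e, 0 < e -> exists2 d, 0 < d & \forall n \near \oo, forall u, `|u - t| <= d ->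
    `|sint (P_ n) (M_ n) (fun x => cos (u * x + c) + k u x) -
      sint (P_ n) (M_ n) (fun x => cos (t * x + c) + k t x)| <= e) ->
  sint (P_ n) (M_ n) (fun x => cos (t * x + c) + k t x) @[n --> \oo] --> 0.
Proof.
move=> bk jk k0 eqV; pose K u x := cos (u * x + c) + k u x.
rewrite -/(K t); apply/cvgrPdist_le => /= e e0.
have e2 : 0 < e / 2 by rewrite divr_gt0.
have [d1 d10 Hd1] := eqV _ e2.
pose d := Num.min d1 1; have d0 : 0 < d by rewrite lt_min d10 ltr01.
have td : t <= t + d by rewrite lerDl ltW.
have sub u : u \in `[t, t + d] -> u \in `[t, t + 1].
  rewrite !in_itv/= => /andP[-> h]; rewrite (le_trans h)// lerD2l.
  by rewrite ge_min lexx orbT.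
have jk' : @jbounded _ T R k t (t + d) C.
  by case: jk => mk hk; split => // u x /sub; exact: hk.
have jc : @jbounded _ T R (fun u x => cos (u * x + c)) t (t + d) 1.
  by split=> [|u x _]; [meas|exact: cos_max].
have jK : @jbounded _ T R K t (t + d) (1 + C).
  split; first by apply: measurable_funD; [case: jc|case: jk].
  move=> u x ut; rewrite (le_trans (ler_normD _ _))// lerD//.
    exact: jc.2.
  exact: jk'.2.
have [cf vf bf] := @cos_average_vanishes R t (t + d) c td.
have Ac : sint (P_ n) (M_ n) (fun x => \int[leb]_(u in `[t, t + d]) K u x)
    @[n --> \oo] --> 0.
  have -> : (fun n => sint (P_ n) (M_ n) (fun x => \int[leb]_(u in `[t, t + d]) K u x)) =
      (fun n => sint (P_ n) (M_ n) (fun x => \int[leb]_(u in `[t, t + d]) cos (u * x + c)) +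
                sint (P_ n) (M_ n) (fun x => \int[leb]_(u in `[t, t + d]) k u x)).
    apply/funext => n; rewrite -sintD//; last exact: (Rint_itv_bmeas (P_ 0) td jk').
    congr sint; apply/funext => x; rewrite RintegralD//.
      exact: (jbounded_integrable_itv x jc).
    exact: (jbounded_integrable_itv x jk').
  rewrite -[X in _ --> X]addr0; apply: cvgD.
    exact: (sint_vanishing HB cD JD cf vf bf).
  by apply: (sint_itv_cvg0 td HB jk') => u _; exact: k0.
have ed0 : 0 < e / 2 * d by rewrite mulr_gt0.
have /cvgrPdist_le/(_ _ ed0) := Ac; apply: filterS2 Hd1 => n Hn.
rewrite (sint_exchange _ _ jK) sub0r normrN => hA.
suff : `|sint (P_ n) (M_ n) (K t)| <= e by rewrite sub0r normrN.
have iK := sint_integrable_itv (P_ n) (M_ n) jK.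
have ic : leb.-integrable `[t, t + d] (EFin \o (fun=> sint (P_ n) (M_ n) (K t))).
  apply: continuous_compact_integrable; first exact: segment_compact.
  by apply: continuous_subspaceT => x; exact: cvg_cst.
have hV : `|\int[leb]_(u in `[t, t + d])
    (sint (P_ n) (M_ n) (K u) - sint (P_ n) (M_ n) (K t))| <= e / 2 * (t + d - t).
  apply: normr_Rint_itv_le => //.
    rewrite (_ : EFin \o _ = (fun u => (sint (P_ n) (M_ n) (K u))%:E -
      (sint (P_ n) (M_ n) (K t))%:E)%E)//.
    exact: integrableB.
  move=> u; rewrite in_itv/= => /andP[tu ud]; apply: Hn.
  rewrite ger0_norm ?subr_ge0// lerBlDl (le_trans ud)// lerD2l.
  by rewrite ge_min lexx.
rewrite RintegralB// in hV; rewrite Rintegral_cst//= lebesgue_measure_itv/= in hV.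
rewrite lte_fin ltrDl d0 -EFinB /= (_ : t + d - t = d) in hV; last by ring.
set V := sint (P_ n) (M_ n) (K t) in hV *; set I := \int[leb]_(u in _) _ in hV hA.
have : `|V| * d <= e * d.
  rewrite -[X in _ * X](gtr0_norm d0) -normrM.
  rewrite (_ : V * d = I - (I - V * d)); last by ring.
  by rewrite (le_trans (ler_normB _ _))//; lra.
by rewrite ler_pM2r.
Qed.

End equicontinuous_transforms.

Section spectral_implies_weak.
Context (R : realType) (tau : R).
Hypothesis tau0 : 0 < tau.
Local Notation T := (measurableTypeR R).
Variables (F_ P_ Q_ : nat -> {finite_measure set T -> \bar R}) (g_ : nat -> R).
Variables (F p q : {finite_measure set T -> \bar R}) (g B : R).
Hypothesis qid_ : forall n, quasi_id tau (F_ n) (P_ n) (Q_ n) (g_ n).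
Hypothesis qidF : quasi_id tau F p q g.
Hypothesis eqF : equicontinuous_fourier F_.
Hypothesis HB : forall n, mass (P_ n) + mass (Q_ n) <= B.
Hypothesis gg : g_ n @[n --> \oo] --> g.

Let J n h := sint (madd (P_ n) q) (madd (Q_ n) p) h.

Variable D : set R.
Hypothesis cD : countable D.
Hypothesis JD : forall a b, ~ D a -> ~ D b -> a <= b ->
  J n (\1_(`]a, b]%classic) : R -> R) @[n --> \oo] --> 0.
Hypothesis J1 : J n (fun=> 1) @[n --> \oo] --> 0.

Let HJ n : mass (madd (P_ n) q) + mass (madd (Q_ n) p) <= B + (mass p + mass q).
Proof. by rewrite !mass_madd; have := HB n; lra. Qed.

Let limit_equicontinuous t e : 0 < e -> exists2 d, 0 < d & forall u, `|u - t| <= d ->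
  `|log_modulus p q u - log_modulus p q t| <= e /\
  `|phase tau p q g u - phase tau p q g t| <= e.
Proof.
move=> e0.
have eq0 : equicontinuous_fourier (fun=> F).
  by apply: (@weak_cvg_equicontinuous _ _ F) => h _ _; exact: cvg_cst.
have [d d0 [N _ /(_ N (leqnn N)) H]] := @exponents_equicontinuous R tau tau0
  (fun=> F) (fun=> p) (fun=> q) (fun=> g) (mass p + mass q) (fun=> qidF)
  (fun=> lexx _) eq0 t e e0.
by exists d.
Qed.

Let J_cosker n u : J n (cosker u) = log_modulus p q u - log_modulus (P_ n) (Q_ n) u.
Proof. by rewrite /J sint_madd ?/log_modulus; [ring|exact: cosker_bmeas]. Qed.

Let J_sinker n u : J n (sinker tau u) =
  phase tau (P_ n) (Q_ n) (g_ n) u - phase tau p q g u - u * (g_ n - g).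
Proof. by rewrite /J sint_madd ?/phase; [ring|exact: sinker_bmeas]. Qed.

Let exponents_equi t e : 0 < e -> exists2 d, 0 < d &
  \forall n \near \oo, forall u, `|u - t| <= d ->
    `|J n (cosker u) - J n (cosker t)| <= e /\
    `|(J n (sinker tau u) + u * (g_ n - g)) - (J n (sinker tau t) + t * (g_ n - g))| <= e.
Proof.
move=> e0; have e2 : 0 < e / 2 by rewrite divr_gt0.
have [d1 d10 H1] := limit_equicontinuous t e2.
have [d2 d20 H2] := exponents_equicontinuous tau0 qid_ HB eqF t e2.
exists (Num.min d1 d2); first by rewrite lt_min d10.
apply: filterS H2 => n Hn u; rewrite le_min => /andP[ud1 ud2].
have [a1 b1] := H1 u ud1; have [a2 b2] := Hn u ud2.
rewrite !J_cosker !J_sinker !subrK; split.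
  by move: a1 a2; rewrite !ler_norml; lra.
by move: b1 b2; rewrite !ler_norml; lra.
Qed.

Let coskerx_cvg0 u : J n (coskerx u) @[n --> \oo] --> 0.
Proof.
exact: (sint_vanishing HJ cD JD (@coskerx_continuous R u) (@coskerx_vanishes R u)
  (@coskerx_bmeas R u)).
Qed.

Let sinkerx_cvg0 u : J n (sinkerx tau u) @[n --> \oo] --> 0.
Proof.
apply: (sint_vanishing HJ cD JD).
- exact: sinkerx_continuous.
- exact: sinkerx_vanishes.
- exact: sinkerx_bmeas.
Qed.

Let cosker_cvg0 t : J n (cosker t) @[n --> \oo] --> 0.
Proof.
have E n u : J n (fun x => cos (u * x + 0) + - coskerx u x) = J n (fun=> 1) - J n (cosker u).
  rewrite /J -sintB; [|exact: bmeas_cst|exact: cosker_bmeas].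
  by congr sint; apply/funext => x; rewrite /cosker addr0; ring.
have : J n (fun x => cos (t * x + 0) + - coskerx t x) @[n --> \oo] --> 0.
  apply: (@sint_cvg0_of_equicontinuous R _ _ _ HJ D cD JD (fun u x => - coskerx u x) 0 t
    ((`|t| + 1) ^+ 2 / 2)).
  - by move=> u; apply: bmeasN; exact: coskerx_bmeas.
  - split; first by apply: measurable_funN; exact: measurable_coskerx2.
    move=> u x; rewrite in_itv/= => /andP[tu ut1].
    rewrite normrN ger0_norm ?coskerx_ge0// (le_trans (coskerx_le _ _))//.
    rewrite ler_wpM2r// -(real_normK (num_real u)) lerXn2r ?nnegrE//.
    by have := ler_norm t; have := ler_norm (- t); rewrite normrN ler_norml; lra.
  - move=> u; have -> : (fun n => sint (madd (P_ n) q) (madd (Q_ n) p) (fun x => - coskerx u x)) =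
        (fun n => (-1) * J n (coskerx u)).
      apply/funext => n; rewrite -sintZ; last exact: coskerx_bmeas.
      by congr sint; apply/funext => x; rewrite mulN1r.
    rewrite -(mulr0 (-1 : R)); apply: cvgM; [exact: cvg_cst|exact: coskerx_cvg0].
  - move=> e e0; have [d d0 H] := exponents_equi t e0; exists d => //.
    apply: filterS H => n Hn u /Hn[h _].
    move: (E n u) (E n t); rewrite /J => -> ->.
    rewrite (_ : _ - _ = - (J n (cosker u) - J n (cosker t))) ?normrN//.
    by rewrite /J; ring.
under eq_fun do rewrite E.
move=> h.
have : J n (fun=> 1) - (J n (fun=> 1) - J n (cosker t)) @[n --> \oo] --> (0 - 0 : R).
  exact: cvgB J1 h.
by rewrite subr0; under eq_fun do rewrite opprB addrC subrK.
Qed.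

Let sin_tau_bounded n : `|J n (fun x => sin (tau * x))| <= B + (mass p + mass q).
Proof.
rewrite (le_trans (sint_le _ _ (sin_bmeas _) (c := 1) _)) ?mul1r ?HJ// => x.
exact: sin_max.
Qed.

Let sinker_shift_cvg0 t :
  J n (fun x => sin (t * x) + sinkerx tau t x) @[n --> \oo] --> 0.
Proof.
have E n u : J n (fun x => cos (u * x + - (pi / 2)) + sinkerx tau u x) =
    J n (sinker tau u) + u / tau * J n (fun x => sin (tau * x)).
  rewrite /J -sintZ; last exact: sin_bmeas.
  rewrite -sintD; [|exact: sinker_bmeas|by apply: bmeasZ; exact: sin_bmeas].
  by congr sint; apply/funext => x; rewrite /sinker cosBpihalf; ring.
have sc : (fun n => J n (fun x => sin (t * x) + sinkerx tau t x)) =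
    (fun n => J n (fun x => cos (t * x + - (pi / 2)) + sinkerx tau t x)).
  by apply/funext => n; congr sint; apply/funext => x; rewrite cosBpihalf.
rewrite sc.
apply: (@sint_cvg0_of_equicontinuous R _ _ _ HJ D cD JD (sinkerx tau) (- (pi / 2)) t
    ((`|t| + 1) ^+ 3 + (`|t| + 1) * tau ^+ 2 + (1 + (`|t| + 1) / tau))).
- by move=> u; exact: sinkerx_bmeas.
- split; first exact: measurable_sinkerx2.
  move=> u x; rewrite in_itv/= => /andP[tu ut1].
  apply: normr_sinkerx_bounded => //.
  by have := ler_norm t; have := ler_norm (- t); rewrite normrN ler_norml; lra.
- exact: sinkerx_cvg0.
- move=> e e0; have e3 : 0 < e / 3 by rewrite divr_gt0.
  have [d1 d10 H1] := exponents_equi t e3.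
  have B0 : 0 <= B + (mass p + mass q).
    by apply: le_trans (HJ 0); rewrite addr_ge0 ?mass_ge0.
  pose d2 := e / 3 / ((B + (mass p + mass q) + 1) / tau).
  have d20 : 0 < d2 by rewrite !divr_gt0// ltr_wpDl.
  exists (Num.min (Num.min d1 d2) 1); first by rewrite !lt_min d10 d20 ltr01.
  have /cvgrPdist_le/(_ _ e3) Hg := gg.
  apply: filterS2 H1 Hg => n Hn hg u; rewrite !le_min => /andP[/andP[ud1 ud2] ud3].
  move: (E n u) (E n t); rewrite /J => -> ->; rewrite -/(J n _) -/(J n _) -/(J n _).
  have [_ h1] := Hn u ud1.
  set a := J n (sinker tau u) in h1 *; set b := J n (sinker tau t) in h1 *.
  set s := J n (fun x => sin (tau * x)).
  have h2 : `|(u - t) * (g_ n - g)| <= e / 3.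
    by rewrite normrM -[leRHS]mul1r ler_pM// distrC.
  have h3 : `|(u - t) * (s / tau)| <= e / 3.
    rewrite normrM; apply: (@le_trans _ _ (d2 * ((B + (mass p + mass q) + 1) / tau))).
      rewrite ler_pM// normrM normfV (gtr0_norm tau0) ler_wpM2r ?invr_ge0 ?(ltW tau0)//.
      by rewrite (le_trans (sin_tau_bounded n))// lerDl.
    by rewrite /d2 divfK// gt_eqF// divr_gt0// ltr_wpDl.
  rewrite (_ : _ - _ = (a + u * (g_ n - g) - (b + t * (g_ n - g)))
     - (u - t) * (g_ n - g) + (u - t) * (s / tau)); last first.
    by field; rewrite gt_eqF.
  by move: h1 h2 h3; rewrite !ler_norml; lra.
Qed.

(* At t = tau the corrected phase reduces to the integral of sin (tau x). *)
Let sin_tau_cvg0 : J n (fun x => sin (tau * x)) @[n --> \oo] --> 0.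
Proof.
have := @sinker_shift_cvg0 tau.
rewrite (_ : (fun x => sin (tau * x) + sinkerx tau tau x) = (fun x => sin (tau * x)))//.
by apply/funext => x; rewrite sinkerxtau// addr0.
Qed.

Let sinker_cvg0 t : J n (sinker tau t) @[n --> \oo] --> 0.
Proof.
have -> : (fun n => J n (sinker tau t)) = (fun n =>
    J n (fun x => sin (t * x) + sinkerx tau t x) - t / tau * J n (fun x => sin (tau * x))).
  apply/funext => n; rewrite /J -sintZ; last exact: sin_bmeas.
  rewrite -sintB; last by apply: bmeasZ; exact: sin_bmeas.
    by congr sint; apply/funext => x; rewrite /sinker; ring.
  by apply: bmeasD; [exact: sin_bmeas|exact: sinkerx_bmeas].
rewrite -[X in _ --> X](_ : 0 - t / tau * 0 = 0); last by rewrite mulr0 subr0.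
by apply: cvgB; [exact: sinker_shift_cvg0|apply: cvgM; [exact: cvg_cst|exact: sin_tau_cvg0]].
Qed.

Lemma fourier_cvg_of_spectral t :
  \int[F_ n]_x cos (t * x) @[n --> \oo] --> \int[F]_x cos (t * x) /\
  \int[F_ n]_x sin (t * x) @[n --> \oo] --> \int[F]_x sin (t * x).
Proof.
have lm : log_modulus (P_ n) (Q_ n) t @[n --> \oo] --> log_modulus p q t.
  have -> : (fun n => log_modulus (P_ n) (Q_ n) t) =
      (fun n => log_modulus p q t - J n (cosker t)).
    by apply/funext => n; rewrite J_cosker; ring.
  rewrite -[X in _ --> X]subr0; apply: cvgB; [exact: cvg_cst|exact: cosker_cvg0].
have ph : phase tau (P_ n) (Q_ n) (g_ n) t @[n --> \oo] --> phase tau p q g t.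
  have -> : (fun n => phase tau (P_ n) (Q_ n) (g_ n) t) =
      (fun n => J n (sinker tau t) + phase tau p q g t + t * (g_ n - g)).
    by apply/funext => n; rewrite J_sinker; ring.
  rewrite -[X in _ --> X](_ : 0 + phase tau p q g t + t * (g - g) = _); last by ring.
  apply: cvgD; first by apply: cvgD; [exact: sinker_cvg0|exact: cvg_cst].
  by apply: cvgM; [exact: cvg_cst|apply: cvgB => //; exact: cvg_cst].
have ex : expR (log_modulus (P_ n) (Q_ n) t) @[n --> \oo] --> expR (log_modulus p q t).
  by apply: continuous_cvg lm; exact: continuous_expR.
have [-> ->] := qidF t; split.
  under eq_fun do rewrite (qid_ _ t).1.
  by apply: cvgM => //; apply: continuous_cvg ph; exact: continuous_cos.
under eq_fun do rewrite (qid_ _ t).2.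
by apply: cvgM => //; apply: continuous_cvg ph; exact: continuous_sin.
Qed.

End spectral_implies_weak.

(** * Spectral functions and their measures *)

Section spectral_measures.
Context (R : realType).
Local Notation T := (measurableTypeR R).
Implicit Types (nu : {charge set T -> \bar R}) (G : R -> R).

Definition hahn_sets nu := svalP (cid (svalP (cid (Hahn_decomposition nu)))).

Definition upper_part nu : {finite_measure set T -> \bar R} := jordan_pos (hahn_sets nu).
Definition lower_part nu : {finite_measure set T -> \bar R} := jordan_neg (hahn_sets nu).

Lemma charge_integralE nu h :
  charge_integral nu h = sint (upper_part nu) (lower_part nu) h.
Proof. by []. Qed.

Lemma charge_partsE nu (A : set T) : measurable A ->
  nu A = (fine (upper_part nu A) - fine (lower_part nu A))%:E.
Proof.
move=> mA; rewrite (jordan_decomp (hahn_sets nu) mA) /cadd/= cscaleN1 EFinB.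
by rewrite !fineK ?fin_num_measure.
Qed.

Lemma stieltjes_increment G nu a b : is_stieltjes_charge G nu -> a <= b ->
  sint (upper_part nu) (lower_part nu) (\1_(`]a, b]%classic) : R -> R) = G b - G a.
Proof.
move=> Gnu ab; have := Gnu a b ab; rewrite charge_partsE// => -[<-].
by rewrite /sint !Rint_indic.
Qed.

(** The increments over ]a, x] differ from the total mass by the tails, which are
    uniformly small once a <= - N and N <= x. *)
Lemma stieltjes_cvg_pinfty G nu : is_stieltjes_charge G nu ->
  G x @[x --> -oo] --> 0 ->
  G x @[x --> +oo] --> mass (upper_part nu) - mass (lower_part nu).
Proof.
move=> Gnu G0; apply/cvgrPdist_le => /= e e0.
set p := upper_part nu; set m := lower_part nu.
have e3 : 0 < e / 3 by rewrite divr_gt0.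
have [N1 H1] := tail_small p e3; have [N2 H2] := tail_small m e3.
pose N := maxn N1 N2.
have [a [aN Ga]] : exists a, a <= - N%:R /\ `|G a| <= e / 3.
  have /cvgrPdist_le/(_ _ e3) h := G0.
  near (-oo%R : set_system R) => a; exists a; split; near: a.
    apply: nbhs_ninfty_le; exact: num_real.
  by apply: filterS h => a; rewrite sub0r normrN.
near=> x; have Nx : N%:R <= x by near: x; apply: nbhs_pinfty_ge; exact: num_real.
have N1N : N1%:R <= N%:R :> R by rewrite ler_nat leq_maxl.
have N2N : N2%:R <= N%:R :> R by rewrite ler_nat leq_maxr.
have N0 : 0 <= N%:R :> R by [].
have ax : a <= x by lra.
have bI : @bmeas _ T R (\1_(`]a, x]%classic) : R -> R) by exact: bmeas_indic.
have b1 : @bmeas _ T R (fun x : R => 1 : R) by exact: bmeas_cst.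
have E : G x = G a + (mass p - mass m) -
    sint p m (fun y => 1 - \1_(`]a, x]%classic) y).
  rewrite sintB// sint_cst mul1r (stieltjes_increment Gnu ax); ring.
have t1 : \int[p]_y (1 - \1_(`]a, x]%classic) y) <= e / 3 by apply: H1; lra.
have t2 : \int[m]_y (1 - \1_(`]a, x]%classic) y) <= e / 3 by apply: H2; lra.
have pos (q : {finite_measure set T -> \bar R}) :
    0 <= \int[q]_y (1 - \1_(`]a, x]%classic) y).
  by apply: Rintegral_ge0 => y _; rewrite indicE; case: (_ \in _); rewrite ?subrr ?subr0.
have := pos p; have := pos m; rewrite E /sint.
by move: Ga; rewrite !ler_norml; lra.
Unshelve. all: by end_near. Qed.

Lemma at_pinftyE G nu : is_stieltjes_charge G nu -> classV G ->
  at_pinfty G = mass (upper_part nu) - mass (lower_part nu).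
Proof.
by move=> Gnu [_ _ G0]; apply/cvg_lim => //; exact: stieltjes_cvg_pinfty.
Qed.

Lemma monotone_classV_cvg_pinfty G : classV G -> {homo G : x y / x <= y} ->
  cvg (G x @[x --> +oo]).
Proof.
move=> [[M HM] _ _] Gnd.
have ubG : has_ubound (range G).
  exists (G 0 + `|M|) => _ [x _ <-].
  have [x0|x0] := leP x 0.
    by rewrite (le_trans (Gnd _ _ x0))// lerDl.
  rewrite -lerBlDl (le_trans (ler_norm _))// (le_trans _ (ler_norm M))//.
  rewrite -lee_fin (le_trans _ (HM 0 x (ltW x0)))//.
  by apply: total_variation_ge; exact: ltW.
have supG : has_sup (range G) by split => //; exists (G 0); exists 0.
apply/cvg_ex; exists (sup (range G)); apply/cvgrPdist_le => /= e e0.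
have [_ [x0 _ <-] Gx0] := sup_adherent e0 supG.
near=> x; have x0x : x0 <= x by near: x; apply: nbhs_pinfty_ge; exact: num_real.
have h1 : G x <= sup (range G) by apply: ub_le_sup => //; exists x.
rewrite ger0_norm ?subr_ge0//.
by have := Gnd _ _ x0x; lra.
Unshelve. all: by end_near. Qed.

Lemma monotone_classV_le_pinfty G : classV G -> {homo G : x y / x <= y} ->
  forall x, G x <= at_pinfty G.
Proof.
move=> VG Gnd x; apply: limr_ge; first exact: monotone_classV_cvg_pinfty.
by near=> y; apply: Gnd; near: y; apply: nbhs_pinfty_ge; exact: num_real.
Unshelve. all: by end_near. Qed.

Lemma monotone_classV_ge0 G : classV G -> {homo G : x y / x <= y} ->
  forall x, 0 <= G x.
Proof.
move=> [_ _ G0] Gnd x; rewrite -(cvg_lim _ G0)//.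
apply: limr_le; first by apply/cvg_ex; exists 0.
by near=> y; apply: Gnd; near: y; apply: nbhs_ninfty_le; exact: num_real.
Unshelve. all: by end_near. Qed.

Lemma monotone_classV_measure G : classV G -> {homo G : x y / x <= y} ->
  exists mu : {measure set T -> \bar R},
    (forall a b, a <= b -> mu `]a, b]%classic = (G b - G a)%:E) /\
    (mu setT <= (at_pinfty G)%:E)%E.
Proof.
move=> VG Gnd; have [_ Grc _] := VG.
pose build := isCumulative.Build R _ R G Gnd Grc.
pose Gc : cumulative R R := HB.pack G build.
exists (lebesgue_stieltjes_measure Gc).
have itvE a b : a <= b ->
    lebesgue_stieltjes_measure Gc `]a, b]%classic = (G b - G a)%:E.
  move=> ab; rewrite /lebesgue_stieltjes_measure /measure_extension.
  by rewrite measurable_mu_extE/=; [rewrite wlength_itv_bnd|exact: is_ocitv].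
split => //.
have cover : \bigcup_k `](- k%:R : R), k%:R]%classic = setT by exact: (bigcup_itvT false false).
have cv : lebesgue_stieltjes_measure Gc `](- k%:R : R), k%:R]%classic @[k --> \oo] -->
    lebesgue_stieltjes_measure Gc (\bigcup_k `](- k%:R : R), k%:R]%classic).
  apply: nondecreasing_cvg_mu => //; first exact: bigcup_measurable.
  by move=> i j ij; apply/subsetPset/subset_itv; rewrite leBSide/= ?lerN2 ler_nat.
rewrite cover in cv; have limE := cvg_lim (@ereal_hausdorff R) cv.
apply: (@le_trans _ _ (limn (fun k : nat =>
  lebesgue_stieltjes_measure Gc `](- k%:R : R), k%:R]%classic))); first by rewrite limE.
apply: lime_le; first by apply/cvg_ex; eexists; exact: cv.
apply: nearW => k; rewrite itvE ?ge0_cp// lee_fin.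
have := monotone_classV_le_pinfty VG Gnd k%:R.
by have := monotone_classV_ge0 VG Gnd (- k%:R); lra.
Qed.

(** The Jordan decomposition is minimal: p + mu_m and m + mu_p agree on intervals,
    hence on all Borel sets, and on the negative set of the Hahn decomposition
    p vanishes while m has its full mass. *)
Lemma lower_part_minimal G Gp Gm nu : is_stieltjes_charge G nu ->
  (forall x, G x = Gp x - Gm x) ->
  classV Gp -> classV Gm -> {homo Gp : x y / x <= y} -> {homo Gm : x y / x <= y} ->
  mass (lower_part nu) <= at_pinfty Gm.
Proof.
move=> Gnu GE Vp Vm ndp ndm.
have [mp [mpE mpT]] := monotone_classV_measure Vp ndp.
have [mm [mmE mmT]] := monotone_classV_measure Vm ndm.
set p := upper_part nu; set m := lower_part nu.
pose m1 : {measure set T -> \bar R} := measure_add p mm.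
pose m2 : {measure set T -> \bar R} := measure_add m mp.
have m1E A : m1 A = (p A + mm A)%E by exact: measure_addE.
have m2E A : m2 A = (m A + mp A)%E by exact: measure_addE.
have eqm : forall A, measurable A -> m1 A = m2 A.
  apply: (@measure_unique _ R T (@ocitv R) (fun k => `](- k%:R), k%:R]%classic)).
  - by [].
  - exact: ocitvI.
  - by move=> k; exact: is_ocitv.
  - exact: (bigcup_itvT false false).
  - move=> A /ocitvP[->|[[a b]/= ab ->]]; first by rewrite !measure0.
    rewrite m1E m2E mmE ?mpE ?(ltW ab)//.
    have := Gnu a b (ltW ab); rewrite charge_partsE// !GE => -[E].
    rewrite -(fineK (fin_num_measure p _ _))// -(fineK (fin_num_measure m _ _))//.
    by rewrite -!EFinD; congr EFin; move: E; lra.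
  - move=> k; rewrite m1E mmE ?ge0_cp//.
    by rewrite -(fineK (fin_num_measure p _ _))// -EFinD ltry.
pose Ps := sval (cid (Hahn_decomposition nu)).
pose Ng := sval (cid (svalP (cid (Hahn_decomposition nu)))).
have [[mP _] [mN _] PNT PN0] := hahn_sets nu.
have pN : p Ng = 0%E.
  transitivity (if Ng \in measurable then nu (Ng `&` Ps) else 0%E) => //.
  by rewrite mem_set// setIC PN0 charge0.
have mNT : m Ng = m setT.
  transitivity (cscale (-1) nu Ng).
    transitivity ((-1)%:E * (if Ng \in measurable then nu (Ng `&` Ng) else 0))%E => //.
    by rewrite mem_set// setIid.
  transitivity ((-1)%:E * (if [set: T] \in measurable then nu (setT `&` Ng) else 0))%E => //.
  by rewrite mem_set// setTI.
have := eqm Ng mN; rewrite m1E m2E pN mNT add0e => E.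
rewrite -lee_fin massE (le_trans _ mmT)//.
apply: (@le_trans _ _ (mm Ng)); last by apply: le_measure; rewrite ?inE.
by rewrite E leeDl.
Qed.

End spectral_measures.

(** * The theorem *)

Section kernel_identification.
Context (R : realType) (tau : R).

Lemma char_funE (F : dfun R) t : char_fun F t =
  (\int[lebesgue_stieltjes_measure F]_x cos (t * x) +i*
   \int[lebesgue_stieltjes_measure F]_x sin (t * x))%C.
Proof.
rewrite /char_fun; congr (_ +i* _)%C; apply: eq_Rintegral => x _ /=;
  by rewrite expR0 mul1r.
Qed.

Lemma Re_levy_kernel t x : complex.Re (levy_kernel tau t x) = - cosker t x.
Proof.
rewrite /levy_kernel /cosker /coskerx; case: eqVneq => [->|x0] /=.
  by rewrite mulr0 cos0 subrr addr0.
by rewrite expR0 mulr0 !subr0 mul1r; field.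
Qed.

Lemma Im_levy_kernel t x : complex.Im (levy_kernel tau t x) = sinker tau t x.
Proof.
rewrite /levy_kernel /sinker /sinkerx; case: eqVneq => [->|x0] /=.
  by rewrite !mulr0 sin0 expr0n/= mulr0 subrr mul0r addr0.
by rewrite expR0; move: (t / tau * sin (tau * x)) => s; field.
Qed.

Lemma quasi_id_of_spectral_pair (F : dfun R) gamma nu :
  (forall t, char_fun F t =
    cexp ((0 +i* (t * gamma))%C + charge_cintegral nu (levy_kernel tau t))) ->
  quasi_id tau (lebesgue_stieltjes_measure F) (upper_part nu) (lower_part nu) gamma.
Proof.
move=> HF t; have := HF t; rewrite char_funE /cexp /charge_cintegral !charge_integralE.
have -> : (fun x => complex.Re (levy_kernel tau t x)) = (fun x => (-1) * cosker t x).
  by apply/funext => x; rewrite Re_levy_kernel mulN1r.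
have -> : (fun x => complex.Im (levy_kernel tau t x)) = sinker tau t.
  by apply/funext => x; rewrite Im_levy_kernel.
rewrite sintZ; last exact: cosker_bmeas.
by rewrite /= add0r mulN1r => -[-> ->].
Qed.

End kernel_identification.

Lemma limn_esup_lty_bounded (R : realType) (u : nat -> R) :
  (limn_esup (fun n => (u n)%:E) < +oo)%E ->
  exists C, \forall n \near \oo, u n <= C.
Proof.
move=> /ereal_inf_lt[_ [V Voo <-] supV].
have [c Hc] : exists c : R, (ereal_sup [set (u n)%:E | n in V] <= c%:E)%E.
  move: supV; case: (ereal_sup _) => [c _|//|_]; first by exists c.
  by exists 0; rewrite leNye.
exists c; apply: filterS Voo => n Vn; rewrite -lee_fin (le_trans _ Hc)//.
by apply: ereal_sup_ubound; exists n.
Qed.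

Theorem theorem10 (R : realType) (tau : R) (tau_gt0 : 0 < tau)
  (F_ : nat -> dfun R)
  (gamma_ : nat -> R) (G_ : nat -> R -> R)
  (F_sp : forall n, spectral_pair tau (F_ n) (gamma_ n) (G_ n))
  (Gp_ Gm_ : nat -> R -> R)
  (Gp_V : forall n, classV (Gp_ n)) (Gm_V : forall n, classV (Gm_ n))
  (Gp_nd : forall n, {homo Gp_ n : x y / x <= y})
  (Gm_nd : forall n, {homo Gm_ n : x y / x <= y})
  (G_dec : forall n x, G_ n x = Gp_ n x - Gm_ n x)
  (Gm_limsup : (limn_esup (fun n => (at_pinfty (Gm_ n))%:E) < +oo)%E)
  (F : dfun R) (gamma : R) (G : R -> R)
  (F0_sp : spectral_pair tau F gamma G) :
  weak_cvg F_ F <->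
  [/\ relatively_compact F_,
      gamma_ n @[n --> \oo] --> gamma,
      basic_cvg G_ G &
      at_pinfty (G_ n) @[n --> \oo] --> at_pinfty G].
Proof.
have [VG [nu [Gnu HF]]] := F0_sp.
have [nu_ Hnu] := choice (fun n => proj2 (F_sp n)).
have VG_ n : classV (G_ n) by have [] := F_sp n.
pose mu (f : dfun R) : {finite_measure set (measurableTypeR R) -> \bar R} :=
  lebesgue_stieltjes_measure f.
have mu1 (f : dfun R) : mass (mu f) = 1.
  exact: (congr1 fine (@probability_setT _ _ _ (lebesgue_stieltjes_measure f))).
pose P_ n := upper_part (nu_ n); pose Q_ n := lower_part (nu_ n).
pose p := upper_part nu; pose q := lower_part nu.
have qid_ n : quasi_id tau (mu (F_ n)) (P_ n) (Q_ n) (gamma_ n).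
  by apply: quasi_id_of_spectral_pair; exact: (Hnu n).2.
have qidF : quasi_id tau (mu F) p q gamma by exact: quasi_id_of_spectral_pair.
have [C QC] : exists C, forall n, mass (Q_ n) <= C.
  have [C /near_seq_bounded[C' HC']] := limn_esup_lty_bounded Gm_limsup.
  exists C' => n; apply: le_trans (HC' n).
  exact: (lower_part_minimal (Hnu n).1 (G_dec n)).
pose J n h := sint (madd (P_ n) q) (madd (Q_ n) p) h.
have J_increment n a b : a <= b -> J n (\1_(`]a, b]%classic) : R -> R) =
    (G_ n b - G_ n a) - (G b - G a).
  move=> ab; rewrite /J sint_madd; last exact: bmeas_indic.
  by rewrite (stieltjes_increment (Hnu n).1 ab) (stieltjes_increment Gnu ab).
have J_total n : J n (fun=> 1) = at_pinfty (G_ n) - at_pinfty G.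
  rewrite /J sint_madd; last exact: bmeas_cst.
  by rewrite (at_pinftyE (Hnu n).1)// (at_pinftyE Gnu)// !sint_cst !mul1r.
split=> [FF|[cptF gg GG infG]].
  have wFF : measures_weak_cvg (fun n => mu (F_ n)) (mu F) by exact: FF.
  have [B PB] := positive_part_bounded tau_gt0 qid_ qidF wFF QC.
  have HJ n : mass (madd (P_ n) q) + mass (madd (Q_ n) p) <= B + mass q + (C + mass p).
    by rewrite !mass_madd; have := PB n; have := QC n; lra.
  have Jf := signed_difference_fourier_cvg0 tau_gt0 qid_ qidF wFF QC.
  split.
  - move=> s ss; exists id; split => //; exists F => h ch hM.
    exact: subseq_cvg ss (FF h ch hM).
  - exact: (drift_cvg tau_gt0 qid_ qidF wFF).
  - move=> s ss.
    have [r [sr [D [cD HD]]]] := sint_itv_cvg0_subseq HJ (fun t => (Jf t).1)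
      (fun t => (Jf t).2) ss.
    exists r; split => //; exists D; split => // x1 x2.
    wlog x12 : x1 x2 / x1 <= x2.
      move=> H D1 D2; have [|/ltW x21] := leP x1 x2; first by move=> /H; exact.
      rewrite -(opprB (G x1)); under eq_fun do rewrite -(opprB (G_ _ x1)).
      by apply: cvgN; exact: H.
    move=> D1 D2; have := HD _ _ D1 D2 x12.
    under eq_fun do rewrite -/(J _ _) J_increment//.
    by move=> /subr_cvg0.
  - have := (Jf 0).1.
    under eq_fun do under eq_fun do rewrite mul0r cos0.
    by under eq_fun do rewrite -/(J _ _) J_total; move=> /subr_cvg0.
move=> h ch [M hM].
apply: (@subseq_cvgr _ (fun n => \int[lebesgue_stieltjes_measure (F_ n)]_x h x)) => s ss.
have [r1 [sr1 [F' FF']]] := cptF s ss.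
have ssr1 := subseq_index_comp ss sr1.
have [r2 [sr2 [D [cD HD]]]] := GG _ ssr1.
have sv : subseq_index (s \o r1 \o r2) by exact: subseq_index_comp.
exists (r1 \o r2); split; first exact: subseq_index_comp.
pose v k := s (r1 (r2 k)).
have [B HB] : exists B, forall n, mass (P_ n) + mass (Q_ n) <= B.
  apply: (@near_seq_bounded _ _ (at_pinfty G + 1 + 2 * C)).
  have /cvgrPdist_le/(_ _ ltr01) := infG; apply: filterS => n.
  rewrite (at_pinftyE (Hnu n).1 (VG_ n)) -/(P_ n) -/(Q_ n) ler_norml => /andP[+ _].
  by have := QC n; lra.
have eqF : equicontinuous_fourier (fun k => mu (F_ (v k))).
  apply: (@weak_cvg_equicontinuous _ _ (mu F')) => g cg gM.
  exact: (subseq_cvg sr2 (FF' g cg gM)).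
have gv : gamma_ (v k) @[k --> \oo] --> gamma by exact: (subseq_cvg sv gg).
have JD a b : ~ D a -> ~ D b -> a <= b ->
    J (v k) (\1_(`]a, b]%classic) : R -> R) @[k --> \oo] --> 0.
  move=> Da Db ab; under eq_fun do rewrite J_increment//.
  by apply/subr_cvg0; exact: HD.
have J1 : J (v k) (fun=> 1) @[k --> \oo] --> 0.
  under eq_fun do rewrite J_total.
  by apply/subr_cvg0; exact: (subseq_cvg sv infG).
have fc := fourier_cvg_of_spectral tau_gt0 (fun k => qid_ (v k)) qidF eqF
  (fun k => HB (v k)) gv cD JD J1.
exact: (levy_continuity (fun k => mu1 (F_ (v k))) (mu1 F) (fun t => (fc t).1)
  (fun t => (fc t).2) ch hM).
Qed.
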